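(* Let $(S^3,g_\epsilon)$, $\epsilon>0$, $\epsilon\neq 1$, be a three-dimensional Berger sphere. Then every one-dimensional metric foliation of $(S^3,g_\epsilon)$ is homogeneous.
   Context: Berger spheres. Let $S^3=\{(z,w)\in\mathbb C^2 : z\bar z+w\bar w=1\}$ with canonical round metric $g_1$ induced from the Euclidean inner product on $\mathbb R^4$. Let $X_{(z,w)}=(iz,iw)$ be the unit $g_1$-Killing field generating the circle action $e^{i\theta}\cdot(z,w)=(e^{i\theta}z,e^{i\theta}w)$, let $\mathcal V$ be the line field spanned by $X$ and $\mathcal H$ its $g_1$-orthogonal distribution. For $\epsilon>0$, $g_\epsilon$ is the Riemannian metric on $S^3$ for which $\mathcal V$ and $\mathcal H$ are orthogonal, $g_\epsilon=\epsilon g_1$ on $\mathcal H$, and $g_\epsilon=\epsilon^2 g_1$ on $\mathcal V$. A Berger sphere is a Riemannian manifold $(S^3,g_\epsilon)$ with $\epsilon>0$, $\epsilon\ne1$. Foliations. Let $\mathcal F$ be a smooth one-dimensional foliation (one-dimensional leaves) of a Riemannian manifold $(M,g)$ with Levi-Civita connection $\nabla$. $\mathcal F$ is metric if its leaves are locally equidistant; equivalently, the orthogonal distribution $T\mathcal F^{\perp}$ is totally geodesic, meaning that whenever $X,Y$ are (local) sections of $T\mathcal F^\perp$, so is $\nabla_XY+\nabla_YX$. $\mathcal F$ is homogeneous if, locally, its leaves are orbits of an isometric group action; that is, each point has a neighborhood carrying a nowhere vanishing Killing field tangent to $\mathcal F$. *)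

(* Defs.v *)
From HB Require Import structures.
From mathcomp Require Import all_boot all_order all_algebra.
From mathcomp Require Import all_classical all_reals all_analysis.
Set Implicit Arguments.
Unset Strict Implicit.
Unset Printing Implicit Defensive.
Import Order.TTheory GRing.Theory Num.Theory.
Import numFieldNormedType.Exports.
Local Open Scope classical_set_scope.
Local Open Scope ring_scope.

(* Iterated directional derivatives: iterD [:: v1; ...; vk] f is             *)
(* D_v1 (... (D_vk f)).                                                      *)
Fixpoint iterD (R : realType) (E F : normedModType R) (s : seq E)
    (f : E -> F) : E -> F :=
  if s is v :: s' then fun x => 'D_v (iterD s' f) x else f.

(* C^oo on O: every iterated directional derivative exists and is            *)
(* (differentiable, hence) continuous at every point of the open set O.      *)
Definition smooth_on (R : realType) (E F : normedModType R) (O : set E)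
    (f : E -> F) : Prop :=
  forall (s : seq E) (x : E), O x -> differentiable (iterD s f) x.

Section Sphere.
Variable R : realType.

(* (x0, x1, x2, x3) stands for (z, w) = (x0 + i x1, x2 + i x3) in C^2.  The  *)
(* library norm on 'rV[R]_4 is the sup norm (same topology as the Euclidean  *)
(* one), so the Euclidean inner product is introduced separately.            *)
Local Notation R4 := ('rV[R]_4).

Definition dot (u v : R4) : R := \sum_i u ord0 i * v ord0 i.

Definition sphere3 : set R4 := [set p | dot p p = 1].

Definition sphere_open (U : set R4) : Prop :=
  exists2 O : set R4, open O & U = sphere3 `&` O.

Definition radial (x : R4) : R4 := (Num.sqrt (dot x x))^-1 *: x.

(* A map on a subset U of the sphere is given by a map on R4 whose values    *)
(* off U are irrelevant.  Calculus on the sphere is done on the extension    *)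
(* f \o radial, constant along rays: since radial is a smooth submersion of  *)
(* R4 minus 0 onto the sphere that restricts to the identity there, f is     *)
(* smooth on U iff f \o radial is smooth on the cone over U, and the         *)
(* differential of f at p along a tangent vector v is that of f \o radial.   *)
Definition sphere_smooth (F : normedModType R) (U : set R4) (f : R4 -> F)
    : Prop :=
  smooth_on [set x | x != 0 /\ U (radial x)] (f \o radial).

Definition sphere_D (F : normedModType R) (f : R4 -> F) (p v : R4) : F :=
  'D_v (f \o radial) p.

Definition tangent (p : R4) : set R4 := [set v | dot p v = 0].

Definition vector_field (U : set R4) (X : R4 -> R4) : Prop :=
  sphere_smooth U X /\ forall p, U p -> tangent p (X p).

Definition bracket (X Y : R4 -> R4) (p : R4) : R4 :=
  sphere_D Y p (X p) - sphere_D X p (Y p).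

(* The vector field (z, w) |-> (i z, i w).                                   *)
Definition hopf_field (p : R4) : R4 :=
  \row_i [:: - p ord0 (inord 1); p ord0 (inord 0);
             - p ord0 (inord 3); p ord0 (inord 2)]`_i.

Definition vert (p u : R4) : R4 := dot u (hopf_field p) *: hopf_field p.
Definition horiz (p u : R4) : R4 := u - vert p u.

Definition berger_metric (eps : R) (p u v : R4) : R :=
  eps * dot (horiz p u) (horiz p v) + eps ^+ 2 * dot (vert p u) (vert p v).

(* nabla acts on local vector fields.  Over an open subset U of the sphere   *)
(* the axioms determine nabla X Y on U from X and Y on U (Koszul formula), so *)
(* one operator serves all U, whatever the junk values off U.                *)
Record levi_civita (eps : R) (nabla : (R4 -> R4) -> (R4 -> R4) -> R4 -> R4)
    : Prop := LeviCivita {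
  lc_field : forall U X Y, sphere_open U ->
    vector_field U X -> vector_field U Y -> vector_field U (nabla X Y);
  lc_addl : forall U X X' Y, sphere_open U ->
    vector_field U X -> vector_field U X' -> vector_field U Y ->
    forall p, U p -> nabla (fun q => X q + X' q) Y p = nabla X Y p + nabla X' Y p;
  lc_scalel : forall U (f : R4 -> R) X Y, sphere_open U ->
    sphere_smooth U (f : R4 -> R^o) ->
    vector_field U X -> vector_field U Y ->
    forall p, U p -> nabla (fun q => f q *: X q) Y p = f p *: nabla X Y p;
  lc_addr : forall U X Y Y', sphere_open U ->
    vector_field U X -> vector_field U Y -> vector_field U Y' ->
    forall p, U p -> nabla X (fun q => Y q + Y' q) p = nabla X Y p + nabla X Y' p;
  lc_leibniz : forall U (f : R4 -> R) X Y, sphere_open U ->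
    sphere_smooth U (f : R4 -> R^o) ->
    vector_field U X -> vector_field U Y ->
    forall p, U p -> nabla X (fun q => f q *: Y q) p =
      (sphere_D (f : R4 -> R^o) p (X p) : R) *: Y p + f p *: nabla X Y p;
  lc_metric : forall U X Y Z, sphere_open U ->
    vector_field U X -> vector_field U Y -> vector_field U Z ->
    forall p, U p ->
      sphere_D ((fun q => berger_metric eps q (Y q) (Z q)) : R4 -> R^o) p (X p) =
      berger_metric eps p (nabla X Y p) (Z p) +
      berger_metric eps p (Y p) (nabla X Z p);
  lc_torsion_free : forall U X Y, sphere_open U ->
    vector_field U X -> vector_field U Y ->
    forall p, U p -> nabla X Y p - nabla Y X p = bracket X Y p }.

(* A one-dimensional foliation is given by its tangent distribution TF, with *)
(* TF p the line tangent at p to the leaf through p: a smooth distribution   *)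
(* of rank one that is integrable, i.e. has an integral curve through each   *)
(* point of the sphere.                                                      *)
Record foliation1 (TF : R4 -> set R4) : Prop := Foliation1 {
  foliation1_smooth : forall p, sphere3 p ->
    exists U T, [/\ sphere_open U, U p, vector_field U T &
      forall q, U q -> T q != 0 /\ TF q = [set a *: T q | a in [set: R]]];
  foliation1_integrable : forall p, sphere3 p ->
    exists (d : R) (c : R^o -> R4),
      [/\ 0 < d, c 0 = p, smooth_on [set t : R^o | `|t| < d] c &
        forall t : R^o, `|t| < d ->
          [/\ sphere3 (c t), 'D_1 c t != 0 & TF (c t) ('D_1 c t)]] }.

Definition orthogonal_section (eps : R) (TF : R4 -> set R4) (U : set R4)
    (X : R4 -> R4) : Prop :=
  vector_field U X /\
  forall p, U p -> forall v, TF p v -> berger_metric eps p (X p) v = 0.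

Definition metric_foliation (eps : R)
    (nabla : (R4 -> R4) -> (R4 -> R4) -> R4 -> R4) (TF : R4 -> set R4) : Prop :=
  forall U X Y, sphere_open U ->
    orthogonal_section eps TF U X -> orthogonal_section eps TF U Y ->
    orthogonal_section eps TF U (fun p => nabla X Y p + nabla Y X p).

(* K is Killing on U: the Lie derivative of the metric along K vanishes.     *)
Definition killing (eps : R) (U : set R4) (K : R4 -> R4) : Prop :=
  vector_field U K /\
  forall W X Y, sphere_open W -> W `<=` U ->
    vector_field W X -> vector_field W Y ->
    forall p, W p ->
      sphere_D ((fun q => berger_metric eps q (X q) (Y q)) : R4 -> R^o) p (K p) =
      berger_metric eps p (bracket K X p) (Y p) +
      berger_metric eps p (X p) (bracket K Y p).

Definition homogeneous_foliation (eps : R) (TF : R4 -> set R4) : Prop :=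
  forall p, sphere3 p ->
    exists U K, [/\ sphere_open U, U p, killing eps U K &
      forall q, U q -> K q != 0 /\ TF q (K q)].

End Sphere.

(* Main.v *)
Require Import Defs.
From HB Require Import structures.
From mathcomp Require Import all_boot all_order all_algebra.
From mathcomp Require Import all_classical all_reals all_analysis.
From mathcomp Require Import ring lra.
Set Implicit Arguments.
Unset Strict Implicit.
Unset Printing Implicit Defensive.
Import Order.TTheory GRing.Theory Num.Theory.
Import numFieldNormedType.Exports.
Local Open Scope classical_set_scope.
Local Open Scope ring_scope.

(* Let T be a unit field tangent to the foliation, k its mean curvature form and a
   the integrability function of its orthogonal distribution.  The foliation is
   metric iff the Lie derivative of the metric along T is the symmetric product of k
   with the dual of T; hence F T is Killing iff dF = - F k, and homogeneity amounts
   to the existence of such an F.  In the left-invariant orthonormal frame e1 (the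
   unit Hopf field), e2, e3 the metric condition determines the derivatives of T from
   k and a.  Where T is not parallel to e1, commuting the derivatives of T in a frame
   adapted to T and e1 determines most derivatives of k and a, and commuting once more
   gives an overdetermined system.  With d = 1 / eps - 1 <> 0 this system forces, on a
   dense set and so everywhere, T to commute with e1 up to multiples of T, and
   d(a + d u^2) = 2 (a + d u^2) k with u = <T, e1>.  Then |a + d u^2|^(-1/2) is a
   suitable F; where a + d u^2 vanishes, u / (1 + a + 2 d u^2) is another one. *)

(** * Derivations of smooth functions *)

(** A nowhere zero F with dF = - F k exists near a point exactly when k is closed there, and the
    mean curvature form of a metric foliation has no reason to be closed in general. The identity
    for d(a + d u^2) settles this where a + d u^2 has no zero, by making k half of a logarithmic
    derivative; it says nothing at the zeros, hence the second formula for F. The value d = 0 is the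
    round metric, and every excluded case is excluded by cancelling d from an equation. The adapted
    frame exists only off the points where T is parallel to e1, and its equations can be solved only
    where certain coefficients do not vanish. This is why the argument runs on a dense set: on an
    open set a function is either identically zero, and then so are its derivatives, or nonzero on a
    smaller open set. The final identities contain no denominators, so they extend by continuity. Up
    to rigidity, only three derivations of a sheaf of functions and their commutators are used; the
    sphere enters afterwards. *)

Lemma lincomb1 (R : pzRingType) (m L1 R1 x y : R) :
  L1 = R1 -> x - y = m * (L1 - R1) -> x = y.
Proof. by move=> -> /eqP; rewrite subrr mulr0 subr_eq0 => /eqP. Qed.

(** Certificates: the cofactors of the known equations are supplied by hand, and what remains is an
    identity for [ring] or [field]. *)
Lemma lincomb2 (R : pzRingType) (m n L1 R1 L2 R2 x y : R) :
  L1 = R1 -> L2 = R2 -> x - y = m * (L1 - R1) + n * (L2 - R2) -> x = y.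
Proof. by move=> -> -> /eqP; rewrite !subrr !mulr0 addr0 subr_eq0 => /eqP. Qed.

Lemma lincomb3 (R : pzRingType) (m n k L1 R1 L2 R2 L3 R3 x y : R) :
  L1 = R1 -> L2 = R2 -> L3 = R3 ->
  x - y = m * (L1 - R1) + n * (L2 - R2) + k * (L3 - R3) -> x = y.
Proof. by move=> -> -> -> /eqP; rewrite !subrr !mulr0 !addr0 subr_eq0 => /eqP. Qed.

Lemma lincomb4 (R : pzRingType) (m n k l L1 R1 L2 R2 L3 R3 L4 R4 x y : R) :
  L1 = R1 -> L2 = R2 -> L3 = R3 -> L4 = R4 ->
  x - y = m * (L1 - R1) + n * (L2 - R2) + k * (L3 - R3) + l * (L4 - R4) -> x = y.
Proof. by move=> -> -> -> -> /eqP; rewrite !subrr !mulr0 !addr0 subr_eq0 => /eqP. Qed.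

Section Calculus.
Variables (R : rcfType) (P : Type) (sm : (P -> Prop) -> (P -> R) -> Prop).

(* [sm V f] stands for: [f] is smooth on [V]. *)
Record smooth_sheaf : Prop := SmoothSheaf {
  smS : forall V W f, (forall p, W p -> V p) -> sm V f -> sm W f;
  sm_ext : forall V f g, (forall p, V p -> f p = g p) -> sm V f -> sm V g;
  smC : forall V k, sm V (fun=> k);
  smD : forall V f g, sm V f -> sm V g -> sm V (fun p => f p + g p);
  smM : forall V f g, sm V f -> sm V g -> sm V (fun p => f p * g p);
  smV : forall V f, (forall p, V p -> f p != 0) -> sm V f -> sm V (fun p => (f p)^-1);
  sm_sqrt : forall V f, (forall p, V p -> 0 < f p) -> sm V f ->
    sm V (fun p => Num.sqrt (f p)) }.

(** [der_ext] is locality: it is what allows an identity that holds only on [V] to be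
    differentiated. *)
Record derivation (V : P -> Prop) (Z : (P -> R) -> P -> R) : Prop := Derivation {
  der_sm : forall f, sm V f -> sm V (Z f);
  der_ext : forall f g, (forall p, V p -> f p = g p) ->
    forall p, V p -> Z f p = Z g p;
  derC : forall k p, V p -> Z (fun=> k) p = 0;
  derD : forall f g, sm V f -> sm V g ->
    forall p, V p -> Z (fun q => f q + g q) p = Z f p + Z g p;
  derM : forall f g, sm V f -> sm V g ->
    forall p, V p -> Z (fun q => f q * g q) p = Z f p * g p + f p * Z g p }.

(** Smoothness and value are bundled so that [der] can compute derivatives of compound expressions
    by unification, with [g] initially unknown. *)
Definition is_der V Z (f g : P -> R) : Prop :=
  sm V f /\ forall p, V p -> Z f p = g p.

Hypothesis smP : smooth_sheaf.
Variables (V : P -> Prop) (Z : (P -> R) -> P -> R).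
Hypothesis derZ : derivation V Z.

Lemma smN f : sm V f -> sm V (fun p => - f p).
Proof.
move=> fs; apply: sm_ext (smM smP (smC smP V (-1)) fs) => //.
by move=> p _; rewrite mulN1r.
Qed.

Lemma is_derE f : sm V f -> is_der V Z f (Z f).
Proof. by []. Qed.

Lemma is_der_ext f g h : (forall p, V p -> f p = h p) ->
  is_der V Z f g -> is_der V Z h g.
Proof.
move=> fh [fs fg]; split; first exact: sm_ext fh fs.
by move=> p Vp; rewrite -fg//; apply: (der_ext derZ) => // q Vq; rewrite fh.
Qed.

Lemma is_der_eqr f g h : (forall p, V p -> g p = h p) ->
  is_der V Z f g -> is_der V Z f h.
Proof. by move=> gh [fs fg]; split=> // p Vp; rewrite fg ?gh. Qed.

Lemma is_der_cst k : is_der V Z (fun=> k) (fun=> 0).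
Proof. by split; [exact: smC|move=> p Vp; apply: derC derZ _ _ Vp]. Qed.

Lemma is_derD f g f' g' : is_der V Z f f' -> is_der V Z g g' ->
  is_der V Z (fun p => f p + g p) (fun p => f' p + g' p).
Proof.
move=> [fs ff'] [gs gg']; split; first exact: smD.
by move=> p Vp; rewrite (derD derZ)// ff'// gg'.
Qed.

Lemma is_derM f g f' g' : is_der V Z f f' -> is_der V Z g g' ->
  is_der V Z (fun p => f p * g p) (fun p => f' p * g p + f p * g' p).
Proof.
move=> [fs ff'] [gs gg']; split; first exact: smM.
by move=> p Vp; rewrite (derM derZ)// ff'// gg'.
Qed.

Lemma is_derN f f' : is_der V Z f f' -> is_der V Z (fun p => - f p) (fun p => - f' p).
Proof.
move=> ff'; have [s E] := is_derM (is_der_cst (-1)) ff'.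
apply: (is_der_ext (f := fun p => -1 * f p)); first by move=> p _; rewrite mulN1r.
by split=> // p Vp; rewrite E// mul0r add0r mulN1r.
Qed.

Lemma is_derX f f' n : is_der V Z f f' ->
  is_der V Z (fun p => f p ^+ n) (fun p => n%:R * f p ^+ n.-1 * f' p).
Proof.
move=> ff'; elim: n => [|n [IHs IH]].
  have [s E] := is_der_cst 1.
  by split=> // p Vp; rewrite E// !mul0r.
have [s E] := is_derM ff' (conj IHs IH).
apply: (is_der_ext (f := fun p => f p * f p ^+ n)); first by move=> p _; rewrite exprS.
split=> // p Vp; rewrite E//=; case: (n) => [|m]; first by rewrite !mul0r expr0; ring.
rewrite [m.+1.-1]/= -[in RHS]natr1 exprS; ring.
Qed.

(** The main tool below: differentiate both sides of an identity and compare. *)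
Lemma is_der_congr f g f' g' : (forall p, V p -> f p = g p) ->
  is_der V Z f f' -> is_der V Z g g' -> forall p, V p -> f' p = g' p.
Proof.
by move=> fg [_ ff'] [_ gg'] p Vp; rewrite -ff'// -gg'//; exact: (der_ext derZ).
Qed.

Lemma is_derV f f' : (forall p, V p -> f p != 0) -> is_der V Z f f' ->
  is_der V Z (fun p => (f p)^-1) (fun p => - f' p * (f p)^-2).
Proof.
move=> f0 [fs ff']; have is' := smV smP f0 fs; split=> // p Vp.
have := derM derZ fs is' Vp.
have -> : Z (fun q => f q * (f q)^-1) p = Z (fun=> 1) p.
  by apply: (der_ext derZ) => // q Vq; rewrite mulfV ?f0.
rewrite (derC derZ)// ff'// => E; apply: (mulfI (f0 _ Vp)).
by apply: (lincomb1 (m := -1) E); field; exact: f0.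
Qed.

Lemma is_der_op (Y : (P -> R) -> P -> R) f g h :
  is_der V Y f g -> is_der V Z g h -> forall p, V p -> Z (Y f) p = h p.
Proof.
by move=> [_ fg] [_ gh] p Vp; rewrite -gh//; exact: (der_ext derZ).
Qed.

End Calculus.

(** * The adapted frame of a Riemannian flow *)

Ltac der_step :=
  first [ eassumption
        | eapply is_der_cst; eassumption
        | eapply is_derD; [eassumption|eassumption| |]
        | eapply is_derN; [eassumption|eassumption|]
        | eapply is_derM; [eassumption|eassumption| |]
        | eapply is_derX; [eassumption|eassumption|]
        | eapply is_derV; [eassumption|eassumption|eassumption|] ].
Ltac der := repeat der_step.

Section Frame.
Variables (R : rcfType) (P : Type) (sm : (P -> Prop) -> (P -> R) -> Prop).
Variables (d : R) (e1 e2 e3 : (P -> R) -> P -> R).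
Variable V : P -> Prop.
Hypothesis smP : smooth_sheaf sm.

Record berger_frame : Prop := BergerFrame {
  der_e1 : derivation sm V e1;
  der_e2 : derivation sm V e2;
  der_e3 : derivation sm V e3;
  comm12 : forall f p, sm V f -> V p ->
    e1 (e2 f) p - e2 (e1 f) p = (2 + 2 * d) * e3 f p;
  comm13 : forall f p, sm V f -> V p ->
    e1 (e3 f) p - e3 (e1 f) p = - (2 + 2 * d) * e2 f p;
  comm23 : forall f p, sm V f -> V p ->
    e2 (e3 f) p - e3 (e2 f) p = 2 * e1 f p }.

Hypothesis eP : berger_frame.

Lemma derivation_comb f1 f2 f3 : sm V f1 -> sm V f2 -> sm V f3 ->
  derivation sm V (fun f p => f1 p * e1 f p + f2 p * e2 f p + f3 p * e3 f p).
Proof.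
have [d1 d2 d3 _ _ _] := eP => s1 s2 s3; split.
- move=> f fs; apply: (smD smP); [apply: (smD smP)|]; apply: (smM smP) => //.
  + exact: der_sm d1 _ fs.
  + exact: der_sm d2 _ fs.
  + exact: der_sm d3 _ fs.
- move=> f g fg p Vp.
  by rewrite (der_ext d1 fg)// (der_ext d2 fg)// (der_ext d3 fg).
- by move=> k p Vp; rewrite (derC d1)// (derC d2)// (derC d3)// !mulr0 !addr0.
- move=> f g fs gs p Vp; rewrite (derD d1)// (derD d2)// (derD d3)//; ring.
- move=> f g fs gs p Vp; rewrite (derM d1)// (derM d2)// (derM d3)//; ring.
Qed.

(* The covariant derivatives of a unit vector field [sum t_i e_i] whose flow is
   Riemannian: [k] is the mean curvature form, [a] the integrability function of
   the orthogonal distribution. *)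
Record riemannian_flow (t1 t2 t3 k1 k2 k3 a : P -> R) : Prop := RiemannianFlow {
  flow_sm : [/\ sm V t1, sm V t2 & sm V t3];
  flow_smk : [/\ sm V k1, sm V k2 & sm V k3];
  flow_sma : sm V a;
  flow_unit : forall p, V p -> t1 p ^+ 2 + t2 p ^+ 2 + t3 p ^+ 2 = 1;
  flow_orth : forall p, V p -> t1 p * k1 p + t2 p * k2 p + t3 p * k3 p = 0;
  flow11 : forall p, V p -> e1 t1 p = t1 p * k1 p;
  flow12 : forall p, V p -> e1 t2 p = t1 p * k2 p - a p * t3 p + (1 + 2 * d) * t3 p;
  flow13 : forall p, V p -> e1 t3 p = t1 p * k3 p + a p * t2 p - (1 + 2 * d) * t2 p;
  flow21 : forall p, V p -> e2 t1 p = t2 p * k1 p + a p * t3 p - t3 p;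
  flow22 : forall p, V p -> e2 t2 p = t2 p * k2 p;
  flow23 : forall p, V p -> e2 t3 p = t2 p * k3 p - a p * t1 p + t1 p;
  flow31 : forall p, V p -> e3 t1 p = t3 p * k1 p - a p * t2 p + t2 p;
  flow32 : forall p, V p -> e3 t2 p = t3 p * k2 p + a p * t1 p - t1 p;
  flow33 : forall p, V p -> e3 t3 p = t3 p * k3 p }.

(* Where [v] does not vanish, [X] is the normalized component of [e1] orthogonal
   to [T], [Y] completes [T], [X] to an orthonormal frame, [(u, v)] and [(C, S)]
   are the cosine and sine of the polar angles of [T] with respect to [e1, e2, e3],
   and [k], [l] are the components of the mean curvature on [X] and [Y]. *)
Record adapted_frame (T X Y : (P -> R) -> P -> R) (u v C S k l a : P -> R) : Prop :=
  AdaptedFrame {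
  adT : derivation sm V T;
  adX : derivation sm V X;
  adY : derivation sm V Y;
  ad_sm : [/\ sm V k, sm V l & sm V a];
  ad_v0 : forall p, V p -> v p != 0;
  ad_uv : forall p, V p -> u p ^+ 2 + v p ^+ 2 = 1;
  ad_CS : forall p, V p -> C p ^+ 2 + S p ^+ 2 = 1;
  ad_TX : forall f p, sm V f -> V p ->
    T (X f) p - X (T f) p = - k p * T f p + (1 + a p - u p * l p / v p) * Y f p;
  ad_TY : forall f p, sm V f -> V p ->
    T (Y f) p - Y (T f) p = - l p * T f p - (1 + a p - u p * l p / v p) * X f p;
  ad_XY : forall f p, sm V f -> V p ->
    X (Y f) p - Y (X f) p = 2 * a p * T f p + (u p * (1 - a p) / v p) * X f p;
  ad_Tu : is_der sm V T u (fun p => v p * k p);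
  ad_Xu : is_der sm V X u (fun=> 0);
  ad_Yu : is_der sm V Y u (fun p => (a p - 1) * v p);
  ad_Tv : is_der sm V T v (fun p => - u p * k p);
  ad_Xv : is_der sm V X v (fun=> 0);
  ad_Yv : is_der sm V Y v (fun p => (1 - a p) * u p);
  ad_TC : is_der sm V T C (fun p => - S p * (- (2 * d) * u p - l p / v p));
  ad_TS : is_der sm V T S (fun p => C p * (- (2 * d) * u p - l p / v p));
  ad_XC : is_der sm V X C (fun p =>
    - S p * (v p * (a p - 1 - 2 * d) - u p ^+ 2 * (1 - a p) / v p));
  ad_XS : is_der sm V X S (fun p =>
    C p * (v p * (a p - 1 - 2 * d) - u p ^+ 2 * (1 - a p) / v p));
  ad_YC : is_der sm V Y C (fun=> 0);
  ad_YS : is_der sm V Y S (fun=> 0) }.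

Variables (t1 t2 t3 k1 k2 k3 a v : P -> R).
Hypothesis tP : riemannian_flow t1 t2 t3 k1 k2 k3 a.
Hypothesis v_sm : sm V v.
Hypothesis v_neq0 : forall p, V p -> v p != 0.
Hypothesis v_sqr : forall p, V p -> v p ^+ 2 = t2 p ^+ 2 + t3 p ^+ 2.

Let C p := t2 p * (v p)^-1.
Let S p := t3 p * (v p)^-1.
Let T f p := t1 p * e1 f p + t2 p * e2 f p + t3 p * e3 f p.
Let X f p := v p * e1 f p + (- (t1 p * C p)) * e2 f p + (- (t1 p * S p)) * e3 f p.
Let Y f p := 0 * e1 f p + S p * e2 f p + (- C p) * e3 f p.
Let k p := k1 p * (v p)^-1.
Let l p := (k2 p * t3 p - k3 p * t2 p) * (v p)^-1.

Let smC' := smC smP. Let smD' := smD smP. Let smM' := smM smP.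
Let smV' := smV smP. Let smN' := smN smP.

Ltac smooth := repeat (first [eassumption | apply: smC' | apply: smD' | apply: smM'
  | apply: smN' | apply: smV']).

(** In components on e1, e2, e3: T = (u, v C, v S), X = (v, - u C, - u S), Y = (0, S, - C), so that
    e1 = u T + v X. The X component of the mean curvature, v k1 - u (C k2 + S k3), equals k1 / v
    because the mean curvature is orthogonal to T. The angle itself is only defined modulo full
    turns, so its cosine and sine are differentiated instead. *)
Lemma adapted_frameP : adapted_frame T X Y t1 v C S k l a.
Proof.
have [[st1 st2 st3] [sk1 sk2 sk3] sa tun tor f11 f12 f13 f21 f22 f23 f31 f32 f33] := tP.
have [d1 d2 d3 co12 co13 co23] := eP.
have sC : sm V C by smooth.
have sS : sm V S by smooth.
have sk : sm V k by smooth.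
have sl : sm V l by smooth.
have dT : derivation sm V T by apply: derivation_comb.
have dX : derivation sm V X by apply: derivation_comb; smooth.
have dY : derivation sm V Y by apply: derivation_comb; smooth.
have uv p : V p -> t1 p ^+ 2 + v p ^+ 2 = 1 by move=> Vp; rewrite v_sqr// addrA tun.
have CS p : V p -> C p ^+ 2 + S p ^+ 2 = 1.
  by move=> Vp; rewrite /C /S !exprMn -mulrDl -v_sqr// -exprMn mulfV ?expr1n ?v_neq0.
have t2E p : V p -> t2 p = v p * C p by move=> Vp; rewrite /C mulrCA mulfV ?mulr1 ?v_neq0.
have t3E p : V p -> t3 p = v p * S p by move=> Vp; rewrite /S mulrCA mulfV ?mulr1 ?v_neq0.
have k1E p : V p -> k1 p = v p * k p by move=> Vp; rewrite /k mulrCA mulfV ?mulr1 ?v_neq0.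
have CSk p : V p -> C p * k2 p + S p * k3 p = - t1 p * k p.
  move=> Vp; apply: (mulfI (v_neq0 Vp)); move: (tor p Vp).
  rewrite t2E// t3E// k1E// => E; apply: (lincomb1 (m := 1) E); ring.
have lE p : V p -> l p = k2 p * S p - k3 p * C p by move=> Vp; rewrite /l /C /S; ring.
have k2E p : V p -> k2 p = - t1 p * C p * k p + S p * l p.
  move=> Vp; apply: (lincomb2 (m := - k2 p) (n := C p) (CS p Vp) (CSk p Vp)).
  rewrite lE//; ring.
have k3E p : V p -> k3 p = - t1 p * S p * k p - C p * l p.
  move=> Vp; apply: (lincomb2 (m := - k3 p) (n := S p) (CS p Vp) (CSk p Vp)).
  rewrite lE//; ring.
have vu p : V p -> v p ^+ 2 = 1 - t1 p ^+ 2 by move=> Vp; rewrite -(uv p Vp); ring.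
have S2 p : V p -> S p ^+ 2 = 1 - C p ^+ 2 by move=> Vp; rewrite -(CS p Vp); ring.
have Tt1 : is_der sm V T t1 (fun p => v p * k p).
  split=> // p Vp; rewrite /T f11// f21// f31// -k1E//.
  by apply: (lincomb1 (m := k1 p) (tun p Vp)); ring.
have Xt1 : is_der sm V X t1 (fun=> 0).
  split=> // p Vp; rewrite /X f11// f21// f31// t2E// t3E//.
  by apply: (lincomb1 (m := - v p * t1 p * k1 p) (CS p Vp)); ring.
have Yt1 : is_der sm V Y t1 (fun p => (a p - 1) * v p).
  split=> // p Vp; rewrite /Y f11// f21// f31// t2E// t3E//.
  by apply: (lincomb1 (m := (a p - 1) * v p) (CS p Vp)); ring.
have vE Z z : derivation sm V Z -> is_der sm V Z t1 z ->
    is_der sm V Z v (fun p => - t1 p * z p * (v p)^-1).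
  move=> dZ Zt1; split=> // p Vp.
  have Zv := is_derE Z v_sm.
  have := is_der_congr dZ (f := fun p => t1 p ^+ 2 + v p ^+ 2) (g := fun=> 1) uv
    ltac:(der) ltac:(der) Vp.
  move=> /= E; apply: (mulfI (v_neq0 Vp)).
  by apply: (lincomb1 (m := 2^-1) E); field; exact: v_neq0.
have Tv : is_der sm V T v (fun p => - t1 p * k p).
  by apply: is_der_eqr (vE _ _ dT Tt1) => p Vp; field; exact: v_neq0.
have Xv : is_der sm V X v (fun=> 0).
  by apply: is_der_eqr (vE _ _ dX Xt1) => p Vp; rewrite mulr0 mul0r.
have Yv : is_der sm V Y v (fun p => (1 - a p) * t1 p).
  by apply: is_der_eqr (vE _ _ dY Yt1) => p Vp; field; exact: v_neq0.
have Tt2 : is_der sm V T t2 (fun p => k2 p + 2 * d * t1 p * t3 p).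
  split=> // p Vp; rewrite /T f12// f22// f32//.
  by apply: (lincomb1 (m := k2 p) (tun p Vp)); ring.
have Tt3 : is_der sm V T t3 (fun p => k3 p - 2 * d * t1 p * t2 p).
  split=> // p Vp; rewrite /T f13// f23// f33//.
  by apply: (lincomb1 (m := k3 p) (tun p Vp)); ring.
have Xt2 : is_der sm V X t2 (fun p =>
    - S p * (v p ^+ 2 * (a p - 1 - 2 * d) - t1 p ^+ 2 * (1 - a p))).
  split=> // p Vp; rewrite /X f12// f22// f32// t2E// t3E//.
  by apply: (lincomb1 (m := - t1 p * v p * k2 p) (CS p Vp)); ring.
have Xt3 : is_der sm V X t3 (fun p =>
    C p * (v p ^+ 2 * (a p - 1 - 2 * d) - t1 p ^+ 2 * (1 - a p))).
  split=> // p Vp; rewrite /X f13// f23// f33// t2E// t3E//.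
  by apply: (lincomb1 (m := - t1 p * v p * k3 p) (CS p Vp)); ring.
have Yt2 : is_der sm V Y t2 (fun p => C p * t1 p * (1 - a p)).
  by split=> // p Vp; rewrite /Y f12// f22// f32// t2E// t3E//; ring.
have Yt3 : is_der sm V Y t3 (fun p => S p * t1 p * (1 - a p)).
  by split=> // p Vp; rewrite /Y f13// f23// f33// t2E// t3E//; ring.
have TC : is_der sm V T C (fun p => - S p * (- (2 * d) * t1 p - l p / v p)).
  have := is_derM smP dT Tt2 (is_derV smP dT v_neq0 Tv).
  apply: is_der_eqr => p Vp; rewrite k2E// t2E// t3E//; field; exact: v_neq0.
have TS : is_der sm V T S (fun p => C p * (- (2 * d) * t1 p - l p / v p)).
  have := is_derM smP dT Tt3 (is_derV smP dT v_neq0 Tv).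
  apply: is_der_eqr => p Vp; rewrite k3E// t2E// t3E//; field; exact: v_neq0.
have XC : is_der sm V X C (fun p =>
    - S p * (v p * (a p - 1 - 2 * d) - t1 p ^+ 2 * (1 - a p) / v p)).
  have := is_derM smP dX Xt2 (is_derV smP dX v_neq0 Xv).
  apply: is_der_eqr => p Vp; rewrite t2E//; field; exact: v_neq0.
have XS : is_der sm V X S (fun p =>
    C p * (v p * (a p - 1 - 2 * d) - t1 p ^+ 2 * (1 - a p) / v p)).
  have := is_derM smP dX Xt3 (is_derV smP dX v_neq0 Xv).
  apply: is_der_eqr => p Vp; rewrite t3E//; field; exact: v_neq0.
have YC : is_der sm V Y C (fun=> 0).
  have := is_derM smP dY Yt2 (is_derV smP dY v_neq0 Yv).
  apply: is_der_eqr => p Vp; rewrite t2E//; field; exact: v_neq0.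
have YS : is_der sm V Y S (fun=> 0).
  have := is_derM smP dY Yt3 (is_derV smP dY v_neq0 Yv).
  apply: is_der_eqr => p Vp; rewrite t3E//; field; exact: v_neq0.
split=> // f p fs Vp.
all: have s1 := der_sm d1 fs; have s2 := der_sm d2 fs; have s3 := der_sm d3 fs.
all: have q1 := is_derE T s1; have q2 := is_derE T s2; have q3 := is_derE T s3.
all: have r1 := is_derE X s1; have r2 := is_derE X s2; have r3 := is_derE X s3.
all: have y1 := is_derE Y s1; have y2 := is_derE Y s2; have y3 := is_derE Y s3.
all: have /eqP := co12 f p fs Vp; rewrite subr_eq => /eqP c12.
all: have /eqP := co13 f p fs Vp; rewrite subr_eq => /eqP c13.
all: have /eqP := co23 f p fs Vp; rewrite subr_eq => /eqP c23.
- eassert (E1 : is_der sm V T (X f) _) by (unfold X; der).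
  eassert (E2 : is_der sm V X (T f) _) by (unfold T; der).
  rewrite (proj2 E1)// (proj2 E2)//= {E1 E2} /T /X /Y t2E// t3E//.
  field: c12 c13 c23 (vu p Vp) (S2 p Vp); exact: v_neq0.
- eassert (E1 : is_der sm V T (Y f) _) by (unfold Y; der).
  eassert (E2 : is_der sm V Y (T f) _) by (unfold T; der).
  rewrite (proj2 E1)// (proj2 E2)//= {E1 E2} /T /X /Y t2E// t3E//.
  field: c12 c13 c23 (vu p Vp) (S2 p Vp); exact: v_neq0.
- eassert (E1 : is_der sm V X (Y f) _) by (unfold Y; der).
  eassert (E2 : is_der sm V Y (X f) _) by (unfold X; der).
  rewrite (proj2 E1)// (proj2 E2)//= {E1 E2} /T /X /Y t2E// t3E//.
  field: c12 c13 c23 (vu p Vp) (S2 p Vp); exact: v_neq0.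
Qed.
End Frame.

(** * Integrability conditions *)

Section Relations.
Variables (R : rcfType) (P : Type) (sm : (P -> Prop) -> (P -> R) -> Prop).
Variables (d : R) (V : P -> Prop).
Hypothesis smP : smooth_sheaf sm.
Variables (T X Y : (P -> R) -> P -> R) (u v C S k l a : P -> R).
Hypothesis frameP : adapted_frame sm d V T X Y u v C S k l a.

Let dT := adT frameP. Let dX := adX frameP. Let dY := adY frameP.
Let v_neq0 := ad_v0 frameP.
Let Tu := ad_Tu frameP. Let Xu := ad_Xu frameP. Let Yu := ad_Yu frameP.
Let Tv := ad_Tv frameP. Let Xv := ad_Xv frameP. Let Yv := ad_Yv frameP.
Let TC := ad_TC frameP. Let XC := ad_XC frameP. Let YC := ad_YC frameP.
Let TS := ad_TS frameP. Let XS := ad_XS frameP. Let YS := ad_YS frameP.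
(* Modulo [T], the bracket of [T] and [e1] is [- u k X + v w Y]. *)
Let w p := 1 + a p - u p * l p / v p.

(** Applied to a function whose first derivatives are known, the bracket relation becomes an
    integrability condition on those derivatives. *)
Lemma TX_rel f ft fx fy fxt ftx : is_der sm V T f ft -> is_der sm V X f fx ->
  is_der sm V Y f fy -> is_der sm V T fx fxt -> is_der sm V X ft ftx ->
  forall p, V p -> fxt p - ftx p = - k p * ft p + w p * fy p.
Proof.
move=> Tf Xf Yf Txf Xtf p Vp; have := ad_TX frameP (proj1 Tf) Vp.
by rewrite (is_der_op dT Xf Txf)// (is_der_op dX Tf Xtf)// (proj2 Tf)// (proj2 Yf).
Qed.

Lemma TY_rel f ft fx fy fyt fty : is_der sm V T f ft -> is_der sm V X f fx ->
  is_der sm V Y f fy -> is_der sm V T fy fyt -> is_der sm V Y ft fty ->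
  forall p, V p -> fyt p - fty p = - l p * ft p - w p * fx p.
Proof.
move=> Tf Xf Yf Tyf Ytf p Vp; have := ad_TY frameP (proj1 Tf) Vp.
by rewrite (is_der_op dT Yf Tyf)// (is_der_op dY Tf Ytf)// (proj2 Tf)// (proj2 Xf).
Qed.

Lemma XY_rel f ft fx fy fyx fxy : is_der sm V T f ft -> is_der sm V X f fx ->
  is_der sm V Y f fy -> is_der sm V X fy fyx -> is_der sm V Y fx fxy ->
  forall p, V p -> fyx p - fxy p = 2 * a p * ft p + (u p * (1 - a p) / v p) * fx p.
Proof.
move=> Tf Xf Yf Xyf Yxf p Vp; have := ad_XY frameP (proj1 Tf) Vp.
by rewrite (is_der_op dX Yf Xyf)// (is_der_op dY Xf Yxf)// (proj2 Tf)// (proj2 Xf).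
Qed.

Let Ta : is_der sm V T a (T a).
Proof. by apply: is_derE; case: (ad_sm frameP). Qed.
Let Xa0 : is_der sm V X a (X a).
Proof. by apply: is_derE; case: (ad_sm frameP). Qed.
Let Ya0 : is_der sm V Y a (Y a).
Proof. by apply: is_derE; case: (ad_sm frameP). Qed.
Let Tk : is_der sm V T k (T k).
Proof. by apply: is_derE; case: (ad_sm frameP). Qed.
Let Xk0 : is_der sm V X k (X k).
Proof. by apply: is_derE; case: (ad_sm frameP). Qed.
Let Yk0 : is_der sm V Y k (Y k).
Proof. by apply: is_derE; case: (ad_sm frameP). Qed.
Let Tl : is_der sm V T l (T l).
Proof. by apply: is_derE; case: (ad_sm frameP). Qed.
Let Xl0 : is_der sm V X l (X l).
Proof. by apply: is_derE; case: (ad_sm frameP). Qed.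
Let Yl0 : is_der sm V Y l (Y l).
Proof. by apply: is_derE; case: (ad_sm frameP). Qed.

(** X and Y are commuted on u, where X u = 0. The pairs (T, X) and (T, Y) on u give [derX_k] and
    [derY_k]. *)
Lemma derX_a : is_der sm V X a (fun p => 2 * a p * k p).
Proof.
apply: is_der_eqr Xa0 => p Vp; apply: (mulfI (v_neq0 Vp)).
have /= E := XY_rel Tu Xu Yu ltac:(der) ltac:(der) Vp.
by apply: (lincomb1 (m := 1) E); field; exact: v_neq0.
Qed.

Lemma derX_k : is_der sm V X k (fun p => k p ^+ 2 + w p * (1 - a p)).
Proof.
apply: is_der_eqr Xk0 => p Vp; apply: (mulfI (v_neq0 Vp)).
have /= E := TX_rel Tu Xu Yu ltac:(der) ltac:(der) Vp.
by apply: (lincomb1 (m := - 1) E); rewrite /w; field; exact: v_neq0.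
Qed.

Lemma derY_k : is_der sm V Y k (fun p => T a p + k p * l p).
Proof.
apply: is_der_eqr Yk0 => p Vp; apply: (mulfI (v_neq0 Vp)).
have /= E := TY_rel Tu Xu Yu ltac:(der) ltac:(der) Vp.
by apply: (lincomb1 (m := - 1) E); rewrite /w; field; exact: v_neq0.
Qed.

(** X and Y are commuted on the polar angle of T around e1. The angle form is C dS - S dC, whence
    the cofactors proportional to S and - C of the equations for C and S. The pairs (T, Y) and (T,
    X) on the same angle give [derY_l] and [derX_l]. *)
Lemma derY_a : is_der sm V Y a (fun p => 2 * a p * l p + 4 * d * u p * v p).
Proof.
apply: is_der_eqr Ya0 => p Vp; apply: (mulfI (v_neq0 Vp)).
have /= E1 := XY_rel TC XC YC ltac:(der) ltac:(der) Vp.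
have /= E2 := XY_rel TS XS YS ltac:(der) ltac:(der) Vp.
have CS := ad_CS frameP Vp; have uv := ad_uv frameP Vp.
have v2 : v p ^+ 2 = 1 - u p ^+ 2 by rewrite -uv; ring.
have S2 : S p ^+ 2 = 1 - C p ^+ 2 by rewrite -CS; ring.
apply: (lincomb2 (m := v p ^+ 2 * S p) (n := - C p * v p ^+ 2) E1 E2).
field: v2 S2; exact: v_neq0.
Qed.

Lemma derY_l : is_der sm V Y l (fun p => l p ^+ 2 - a p ^+ 2 + 1 + 4 * d * v p ^+ 2).
Proof.
apply: is_der_eqr Yl0 => p Vp; apply: (mulfI (v_neq0 Vp)).
have /= E1 := TY_rel TC XC YC ltac:(der) ltac:(der) Vp.
have /= E2 := TY_rel TS XS YS ltac:(der) ltac:(der) Vp.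
have CS := ad_CS frameP Vp; have uv := ad_uv frameP Vp.
have v2 : v p ^+ 2 = 1 - u p ^+ 2 by rewrite -uv; ring.
have S2 : S p ^+ 2 = 1 - C p ^+ 2 by rewrite -CS; ring.
apply: (lincomb2 (m := - v p ^+ 2 * S p) (n := C p * v p ^+ 2) E1 E2).
rewrite /w; field: v2 S2; exact: v_neq0.
Qed.

Lemma derX_l : is_der sm V X l (fun p => k p * l p + u p * (1 - a p) * k p / v p - T a p).
Proof.
apply: is_der_eqr Xl0 => p Vp; apply: (mulfI (v_neq0 Vp)).
have /= E1 := TX_rel TC XC YC ltac:(der) ltac:(der) Vp.
have /= E2 := TX_rel TS XS YS ltac:(der) ltac:(der) Vp.
have XaE : X a p = 2 * a p * k p by have [_ ->] := derX_a.
have CS := ad_CS frameP Vp; have uv := ad_uv frameP Vp.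
have v2 : v p ^+ 2 = 1 - u p ^+ 2 by rewrite -uv; ring.
have S2 : S p ^+ 2 = 1 - C p ^+ 2 by rewrite -CS; ring.
apply: (lincomb2 (m := - v p ^+ 2 * S p) (n := C p * v p ^+ 2) E1 E2).
rewrite /w; field: v2 S2; exact: v_neq0.
Qed.

(** X and Y are commuted on a, whose derivatives along both are now known. The factor a on the left
    is the reason for treating the zeros of a separately. *)
Lemma derT_a_eq p : V p -> 3 * (a p * T a p) = - (4 * d) * (u p * v p * k p).
Proof.
move=> Vp; have xa := derX_a; have ya := derY_a; have xk := derX_k.
have yk := derY_k; have xl := derX_l; have yl := derY_l.
have /= E := XY_rel Ta derX_a derY_a ltac:(der) ltac:(der) Vp.
have v2 : v p ^+ 2 = 1 - u p ^+ 2 by rewrite -(ad_uv frameP Vp); ring.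
apply: (lincomb1 (m := -2^-1) E); field: v2; exact: v_neq0.
Qed.

(** Y a = 0 leaves 4 d u v = 0, so u = 0, whereas Y u = - v. *)
Lemma a_eq0_absurd p : d != 0 -> V p -> (forall q, V q -> a q = 0) -> False.
Proof.
move=> d0 Vp a0.
have u0 q : V q -> u q = 0.
  move=> Vq; have := is_der_congr dY a0 derY_a (is_der_cst smP dY 0) Vq.
  rewrite /= a0// mulr0 mul0r add0r -!mulrA => /eqP.
  by rewrite !mulf_eq0 (negbTE d0) (negbTE (v_neq0 Vq)) pnatr_eq0 orbF/= => /eqP.
have := is_der_congr dY u0 Yu (is_der_cst smP dY 0) Vp.
rewrite a0// sub0r mulN1r => /eqP; rewrite oppr_eq0.
exact/negP/v_neq0.
Qed.

(** X k = 0 gives a = 1, then Y a = 0 gives l = - 2 d u v, and differentiating this along Y gives d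
    u^2 = - 1, which makes w = 2 + 2 d u^2 vanish. *)
Lemma geodesic_w_neq0_absurd p : d != 0 -> V p -> (forall q, V q -> k q = 0) ->
  (forall q, V q -> w q != 0) -> False.
Proof.
move=> d0 Vp k0 w0.
have a1 q : V q -> a q = 1.
  move=> Vq; have := is_der_congr dX k0 derX_k (is_der_cst smP dX 0) Vq.
  rewrite /= k0// expr0n add0r => /eqP; rewrite mulf_eq0 (negbTE (w0 _ Vq))/=.
  by rewrite subr_eq0 => /eqP.
have lE q : V q -> l q = - (2 * d) * (u q * v q).
  move=> Vq; have := is_der_congr dY a1 derY_a (is_der_cst smP dY 1) Vq.
  by rewrite /= a1// => E; apply: (lincomb1 (m := 2^-1) E); field.
have /= E := is_der_congr dY lE derY_l ltac:(der) Vp.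
have {E} : 4 * d * v p ^+ 2 * (d * u p ^+ 2 + 1) = 0.
  by move: E; rewrite lE// a1// => E; apply: (lincomb1 (m := 1) E); ring.
have nz : 4 * d * v p ^+ 2 != 0.
  by rewrite mulf_neq0 ?expf_neq0 ?(v_neq0 Vp)// mulf_neq0 ?pnatr_eq0.
move/eqP; rewrite mulf_eq0 (negbTE nz)/= => /eqP E.
have /eqP := w0 _ Vp; apply; rewrite /w a1// lE//.
by apply: (lincomb1 (m := 2) E); field; exact: v_neq0.
Qed.

(** * The generic case: d, a, u and k without zeros *)

Section Generic.
Hypotheses (d_neq0 : d != 0) (a_neq0 : forall p, V p -> a p != 0)
  (u_neq0 : forall p, V p -> u p != 0) (k_neq0 : forall p, V p -> k p != 0).

Lemma derT_a : is_der sm V T a (fun p => - (4 * d) / 3 * (u p * v p * k p) / a p).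
Proof.
apply: is_der_eqr Ta => p Vp.
by apply: (lincomb1 (m := (3 * a p)^-1) (derT_a_eq Vp)); field; rewrite a_neq0.
Qed.

(** T and X are commuted on a; T and Y on a give [derT_l]. *)
Lemma derT_k : is_der sm V T k (fun p =>
  (4 * d * u p * v p / (3 * a p) * (4 * k p ^+ 2 - w p * (1 - a p))
   + w p * (2 * a p * l p + 4 * d * u p * v p)) / (2 * a p)).
Proof.
have ta := derT_a; have xa := derX_a; have ya := derY_a; have xk := derX_k.
have a0 := a_neq0.
apply: is_der_eqr Tk => p Vp; apply: (mulfI (a_neq0 Vp)).
have /= E := TX_rel ta xa ya ltac:(der) ltac:(der) Vp.
apply: (lincomb1 (m := 2^-1) E); rewrite /w; field; by rewrite v_neq0 ?a_neq0.
Qed.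

Lemma derT_l : is_der sm V T l (fun p =>
  (- (4 * d) / (3 * a p) * ((1 - a p) * k p * (u p ^+ 2 - v p ^+ 2)
      + u p * v p * (T a p + k p * l p)
      - u p * v p * k p * (2 * a p * l p + 4 * d * u p * v p) / a p)
   - 3 * T a p * l p - 4 * d * k p * (v p ^+ 2 - u p ^+ 2) - 2 * a p * k p * w p) / (2 * a p)).
Proof.
have ta := derT_a; have xa := derX_a; have ya := derY_a; have yk := derY_k.
have a0 := a_neq0.
apply: is_der_eqr Tl => p Vp; apply: (mulfI (a_neq0 Vp)).
have /= E := TY_rel ta xa ya ltac:(der) ltac:(der) Vp.
move: E; rewrite (proj2 ta)// => E.
apply: (lincomb1 (m := 2^-1) E); rewrite /w; field; by rewrite v_neq0 ?a_neq0.
Qed.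

(** T and X are commuted on k. All first derivatives being known by now, this is a relation free of
    derivatives, from which the common factor d u v k has been cancelled. *)
Lemma generic_k_sqr p : V p -> 60 * a p * k p ^+ 2 = 30 * a p * w p * (1 - 2 * a p)
  + 18 * a p - 30 * a p ^+ 2 - 32 * d * a p * u p ^+ 2 + 20 * d * u p ^+ 2.
Proof.
have ta := derT_a; have tk := derT_k; have tl := derT_l.
have xa := derX_a; have ya := derY_a; have xk := derX_k.
have yk := derY_k; have xl := derX_l.
have a0 := a_neq0.
have aa0 q : V q -> 2 * a q != 0 by move=> Vq; rewrite mulf_neq0 ?pnatr_eq0 ?a0.
have aaa0 q : V q -> 3 * a q != 0 by move=> Vq; rewrite mulf_neq0 ?pnatr_eq0 ?a0.
move=> Vp.
have /= E := TX_rel tk xk yk ltac:(der) ltac:(der) Vp.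
move: E; rewrite /= (proj2 ta)// => E.
have v2 : v p ^+ 2 = 1 - u p ^+ 2 by rewrite -(ad_uv frameP Vp); ring.
apply: (lincomb1 (m := 18 * a p ^+ 3 / (4 * d * u p * v p * k p)) E).
rewrite /w; field: v2; by rewrite d_neq0 v_neq0 ?a_neq0 ?u_neq0 ?k_neq0.
Qed.

Lemma derX_w : is_der sm V X w (fun p => k p * (w p - (1 - a p) / v p ^+ 2
  - 4 * d * u p ^+ 2 / (3 * a p))).
Proof.
have xa := derX_a; have xl := derX_l; have ta := derT_a.
eassert (E : is_der sm V X w _) by (unfold w; der).
apply: is_der_eqr E => p Vp /=; rewrite (proj2 ta)// /w.
have v2 : v p ^+ 2 = 1 - u p ^+ 2 by rewrite -(ad_uv frameP Vp); ring.
by field: v2; rewrite v_neq0 ?a_neq0.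
Qed.

(** [generic_k_sqr] is differentiated along X and divided by k; the square of k that remains is
    eliminated by [generic_k_sqr] itself. Since u and v are constant along X, the result is linear
    in w. *)
Lemma generic_w_eq p : V p -> a p * v p ^+ 2 * w p * (50 - 20 * a p) =
  v p ^+ 2 * (- 12 * a p + 48 * d * a p * u p ^+ 2 - 40 * d * u p ^+ 2)
  - 10 * a p * (1 - 2 * a p) * (1 - a p).
Proof.
have xa := derX_a; have xk := derX_k; have xw := derX_w.
move=> Vp; have /= E := is_der_congr dX generic_k_sqr ltac:(der) ltac:(der) Vp.
have F := generic_k_sqr Vp.
apply: (lincomb2 (m := v p ^+ 2 / (3 * k p)) (n := - 4 * v p ^+ 2 / 3) E F).
field; by rewrite v_neq0 ?a_neq0 ?k_neq0.
Qed.

(* Along the orbits of [X], [u] and [v] are constant, [W] satisfies [W' = k W]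
   and [a' = 2 k a]: hence the monomials [a W], [a ^ 2 W], [1], [a] of [generic_w_eq]
   are eigenfunctions of [k ^ -1 X] for distinct eigenvalues 3, 5, 0, 2. *)
Let W p := w p - (1 + a p) / v p ^+ 2 - 4 * d * u p ^+ 2 / (9 * a p).

(** The terms subtracted from w form a particular solution of the inhomogeneous linear equation
    [derX_w]. *)
Let derX_W : is_der sm V X W (fun p => k p * W p).
Proof.
have xa := derX_a; have xw := derX_w; have xv := Xv.
have v2n q : V q -> v q ^+ 2 != 0 by move=> Vq; rewrite expf_neq0 ?v_neq0.
have aaa0 q : V q -> 9 * a q != 0 by move=> Vq; rewrite mulf_neq0 ?pnatr_eq0 ?a_neq0.
eassert (E : is_der sm V X W _) by (unfold W; der).
apply: is_der_eqr E => p Vp /=; rewrite /W.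
by field; rewrite v_neq0 ?a_neq0.
Qed.

(** What is left of [generic_w_eq] once w is expressed by [W]: the terms in a^2 and a^3 cancel,
    leaving a constant term and one in a. *)
Let A0 p := - (560 / 9) * d * u p ^+ 2 * v p ^+ 2.
Let A1 p := v p ^+ 2 * (- 12 + 512 / 9 * d * u p ^+ 2) - 60.

Lemma generic_iterated_w_eq n p : V p ->
  3 ^+ n * (50 * v p ^+ 2 * a p * W p) - 5 ^+ n * (20 * v p ^+ 2 * a p ^+ 2 * W p) =
  0 ^+ n * A0 p + 2 ^+ n * (A1 p * a p).
Proof.
elim: n p => [|n IH] p Vp.
  apply: (lincomb1 (m := 1) (generic_w_eq Vp)); rewrite !expr0 /W /A0 /A1.
  field; by rewrite v_neq0 ?a_neq0.
have xa := derX_a; have xW := derX_W; have xv := Xv.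
have XA0 : is_der sm V X A0 (fun=> 0).
  eassert (E : is_der sm V X A0 _) by (unfold A0; der).
  by apply: is_der_eqr E => q Vq /=; ring.
have XA1 : is_der sm V X A1 (fun=> 0).
  eassert (E : is_der sm V X A1 _) by (unfold A1; der).
  by apply: is_der_eqr E => q Vq /=; ring.
have /= E := is_der_congr dX IH ltac:(der) ltac:(der) Vp.
apply: (lincomb1 (m := (k p)^-1) E); rewrite [0 ^+ _]exprS !exprS; field.
exact: k_neq0.
Qed.

(** A Vandermonde argument: the eigenvalues 0, 2, 3, 5 are distinct, so the instances n = 0, 1, 2, 3
    make all four terms vanish, among them [A0], which is a nonzero multiple of d u^2 v^2. *)
Lemma generic_absurd p : V p -> False.
Proof.
move=> Vp.
have E0 := generic_iterated_w_eq 0 Vp; have E1 := generic_iterated_w_eq 1 Vp.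
have E2 := generic_iterated_w_eq 2 Vp; have E3 := generic_iterated_w_eq 3 Vp.
have /eqP : d * u p ^+ 2 * v p ^+ 2 = 0 by rewrite /A0 in E0 E1 E2 E3 *; lra.
by apply/negP; rewrite !mulf_neq0 ?expf_neq0 ?v_neq0 ?u_neq0.
Qed.

End Generic.
End Relations.

(** * Rigidity of Riemannian flows *)

Section Density.
Variables (R : rcfType) (P : Type) (sm : (P -> Prop) -> (P -> R) -> Prop).
Variables (opn : (P -> Prop) -> Prop) (d : R) (e1 e2 e3 : (P -> R) -> P -> R).
Hypothesis smP : smooth_sheaf sm.
Hypothesis opn_neq0 : forall V f, opn V -> sm V f -> opn (fun p => V p /\ f p != 0).
Hypothesis eP : forall V, opn V -> berger_frame sm d e1 e2 e3 V.
Hypothesis d_neq0 : d != 0.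

Lemma dense_zero U f : opn U -> sm U f ->
  (forall V p, opn V -> (forall q, V q -> U q) -> V p -> exists2 q, V q & f q = 0) ->
  forall p, U p -> f p = 0.
Proof.
move=> Uo fs fV p Up; apply/eqP/negP => /negP fp.
have [q [_]] := fV _ p (opn_neq0 Uo fs) (fun q => @proj1 _ _) (conj Up fp).
by move=> /[swap] ->; rewrite eqxx.
Qed.

Variables (t1 t2 t3 k1 k2 k3 a : P -> R).
Local Notation flow V := (riemannian_flow sm d e1 e2 e3 V t1 t2 t3 k1 k2 k3 a).

Lemma flowS U V : (forall p, V p -> U p) -> flow U -> flow V.
Proof.
move=> VU [[? ? ?] [? ? ?] ? *].
by split; first [by split; apply: (smS smP) VU _|by apply: (smS smP) VU _|by auto].
Qed.

Let v p := Num.sqrt (t2 p ^+ 2 + t3 p ^+ 2).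
Let C p := t2 p * (v p)^-1.
Let S p := t3 p * (v p)^-1.
Let T f p := t1 p * e1 f p + t2 p * e2 f p + t3 p * e3 f p.
Let X f p := v p * e1 f p + (- (t1 p * C p)) * e2 f p + (- (t1 p * S p)) * e3 f p.
Let Y f p := 0 * e1 f p + S p * e2 f p + (- C p) * e3 f p.
Let k p := k1 p * (v p)^-1.
Let l p := (k2 p * t3 p - k3 p * t2 p) * (v p)^-1.
Let w p := 1 + a p - t1 p * l p / v p.

Lemma flow_adapted V : opn V -> flow V ->
  (forall p, V p -> t2 p ^+ 2 + t3 p ^+ 2 != 0) ->
  adapted_frame sm d V T X Y t1 v C S k l a.
Proof.
move=> Vo flowV q0.
have pos p : V p -> 0 < t2 p ^+ 2 + t3 p ^+ 2.
  by move=> Vp; rewrite lt_def q0// addr_ge0 ?sqr_ge0.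
apply: adapted_frameP => //.
- exact: eP.
- apply: (sm_sqrt smP) => //; have [[_ s2 s3] _ _ _ _ _ _ _ _ _ _ _ _ _] := flowV.
  apply: (sm_ext smP (f := fun p => t2 p * t2 p + t3 p * t3 p)).
    by move=> p _; rewrite !expr2.
  by apply: (smD smP); apply: (smM smP).
- by move=> p Vp; rewrite gt_eqF// sqrtr_gt0 pos.
- by move=> p Vp; rewrite sqr_sqrtr// ltW ?pos.
Qed.

(* The first three equations say that the field [sum t_i e_i] commutes with [e1]
   up to a multiple of itself, the last three that [a + d * t1 ^+ 2] has
   logarithmic derivative twice the mean curvature. *)
Record rigid (p : P) : Prop := Rigid {
  rigid1 : k1 p = 0;
  rigid2 : t1 p * k2 p = (1 + a p) * t3 p;
  rigid3 : t1 p * k3 p = - (1 + a p) * t2 p;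
  rigid_e1 : e1 a p + 2 * d * t1 p * e1 t1 p = 2 * (a p + d * t1 p ^+ 2) * k1 p;
  rigid_e2 : e2 a p + 2 * d * t1 p * e2 t1 p = 2 * (a p + d * t1 p ^+ 2) * k2 p;
  rigid_e3 : e3 a p + 2 * d * t1 p * e3 t1 p = 2 * (a p + d * t1 p ^+ 2) * k3 p }.

(** Here T is e1 or its opposite, so the mean curvature vanishes and a = 1 on [V]; all six equations
    reduce to 0 = 0. *)
Lemma rigid_vertical V p : opn V -> flow V -> V p ->
  (forall q, V q -> t2 q ^+ 2 + t3 q ^+ 2 = 0) -> rigid p.
Proof.
move=> Vo flowV Vp t0.
have [d1 d2 d3 _ _ _] := eP Vo.
have [[s1 s2 s3] _ sa un og f11 f12 f13 f21 f22 f23 f31 f32 f33] := flowV.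
have t2E q : V q -> t2 q = 0.
  by move=> /t0/eqP; rewrite paddr_eq0 ?sqr_ge0// sqrf_eq0 => /andP[/eqP].
have t3E q : V q -> t3 q = 0.
  by move=> /t0/eqP; rewrite paddr_eq0 ?sqr_ge0// !sqrf_eq0 => /andP[_ /eqP].
have t1N q : V q -> t1 q != 0.
  move=> Vq; apply/eqP => t10; have := un q Vq.
  by rewrite t10 t2E// t3E// expr0n !addr0 => /eqP; rewrite eq_sym oner_eq0.
have z2 Z q : derivation sm V Z -> V q -> Z t2 q = 0.
  by move=> dZ Vq; rewrite (der_ext dZ t2E) ?(derC dZ).
have z3 Z q : derivation sm V Z -> V q -> Z t3 q = 0.
  by move=> dZ Vq; rewrite (der_ext dZ t3E) ?(derC dZ).
have k1E q : V q -> k1 q = 0.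
  move=> Vq; apply: (mulfI (t1N _ Vq)); have := og q Vq.
  by rewrite t2E// t3E// !mul0r !addr0 mulr0.
have k2E q : V q -> k2 q = 0.
  move=> Vq; apply: (mulfI (t1N _ Vq)); have := f12 q Vq.
  by rewrite z2// t3E// !mulr0 subr0 addr0.
have k3E q : V q -> k3 q = 0.
  move=> Vq; apply: (mulfI (t1N _ Vq)); have := f13 q Vq.
  by rewrite z3// t2E// !mulr0 subr0 addr0.
have aE q : V q -> a q = 1.
  move=> Vq; have := f23 q Vq; rewrite z3// t2E// mul0r => E.
  by apply: (mulIf (t1N _ Vq)); apply: (lincomb1 (m := 1) E); ring.
have za Z : derivation sm V Z -> Z a p = 0.
  by move=> dZ; rewrite (der_ext dZ aE) ?(derC dZ).
split; rewrite ?za ?f11 ?f21 ?f31 ?k1E ?k2E ?k3E ?t2E ?t3E //; ring.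
Qed.

(** k = w = 0 makes the bracket of T and e1 a multiple of T, and w = 0 reads u l = (1 + a) v. Then X
    a = 0, T a = 0 by [derT_a_eq] since a is nonzero, and Y (a + d u^2) = 2 a l + 2 d u v (1 + a) =
    2 (a + d u^2) l. *)
Lemma rigid_adapted V p : opn V -> flow V -> V p ->
  (forall q, V q -> t2 q ^+ 2 + t3 q ^+ 2 != 0) ->
  a p != 0 -> k p = 0 -> w p = 0 -> rigid p.
Proof.
move=> Vo flowV Vp q0 a0 k0 w0; have ad := flow_adapted Vo flowV q0.
have [[s1 s2 s3] _ sa un og f11 f12 f13 f21 f22 f23 f31 f32 f33] := flowV.
have v0 := ad_v0 ad Vp; have CS := ad_CS ad Vp; have uv := ad_uv ad Vp.
have k10 : k1 p = 0.
  by apply/eqP; move/eqP: k0; rewrite /k mulf_eq0 invr_eq0 (negbTE v0) orbF.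
have vv : v p ^+ 2 = t2 p ^+ 2 + t3 p ^+ 2.
  by rewrite sqr_sqrtr// addr_ge0 ?sqr_ge0.
have t2E : t2 p = v p * C p by rewrite /C; field.
have t3E : t3 p = v p * S p by rewrite /S; field.
have lE : t1 p * l p = (1 + a p) * v p.
  by apply: (lincomb1 (m := - v p) w0); rewrite /w; field.
have og' : C p * k2 p + S p * k3 p = 0.
  apply: (mulfI v0); apply: (lincomb1 (m := 1) (og p Vp)); rewrite k10 t2E t3E; ring.
have lE' : l p = k2 p * S p - k3 p * C p.
  by rewrite /l /C /S; ring.
have k2E : k2 p = S p * l p.
  by rewrite lE'; apply: (lincomb2 (m := C p) (n := - k2 p) og' CS); ring.
have k3E : k3 p = - C p * l p.
  by rewrite lE'; apply: (lincomb2 (m := S p) (n := - k3 p) og' CS); ring.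
have S2 : S p ^+ 2 = 1 - C p ^+ 2 by rewrite -CS; ring.
have v2 : v p ^+ 2 = 1 - t1 p ^+ 2 by rewrite -uv; ring.
have Xa : X a p = 0 by have [_ ->] := derX_a smP ad; rewrite // k0 mulr0.
have Ya : Y a p = 2 * a p * l p + 4 * d * t1 p * v p by have [_ ->] := derY_a smP ad.
have Ta : T a p = 0.
  have := derT_a_eq smP ad Vp; rewrite k0 !mulr0 => /eqP.
  by rewrite !mulf_eq0 pnatr_eq0 (negbTE a0)/= => /eqP.
have e1a : e1 a p = 0.
  apply: (lincomb2 (m := t1 p) (n := v p) Ta Xa).
  by rewrite /T /X t2E t3E; ring: v2.
have e2a : e2 a p = S p * Y a p.
  apply: (lincomb2 (m := t2 p) (n := - (t1 p * C p)) Ta Xa).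
  by rewrite /T /X /Y t2E t3E; ring: v2 S2.
have e3a : e3 a p = - C p * Y a p.
  apply: (lincomb2 (m := t3 p) (n := - (t1 p * S p)) Ta Xa).
  by rewrite /T /X /Y t2E t3E; ring: v2 S2.
split=> //.
- by rewrite k2E t3E; apply: (lincomb1 (m := S p) lE); ring.
- by rewrite k3E t2E; apply: (lincomb1 (m := - C p) lE); ring.
- by rewrite e1a f11// k10; ring.
- rewrite e2a Ya f21// k10 k2E t3E.
  by apply: (lincomb1 (m := - (2 * d * S p * t1 p)) lE); ring.
- rewrite e3a Ya f31// k10 k3E t2E.
  by apply: (lincomb1 (m := 2 * d * C p * t1 p) lE); ring.
Qed.

(** A single rigid point is wanted, so [V] may be shrunk whenever a function is not identically
    zero. Two cases survive: T vertical on all of [V], or k identically zero on [V2] with a zero of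
    w; all the others are contradictory. *)
Lemma rigid_dense V p : opn V -> flow V -> V p -> exists2 q, V q & rigid q.
Proof.
move=> Vo flowV Vp.
have [[s1 s2 s3] [sk1 sk2 sk3] sa _ _ _ _ _ _ _ _ _ _ _] := flowV.
have sq : sm V (fun q => t2 q ^+ 2 + t3 q ^+ 2).
  apply: (sm_ext smP (f := fun p => t2 p * t2 p + t3 p * t3 p)).
    by move=> q _; rewrite !expr2.
  by apply: (smD smP); apply: (smM smP).
have [t0|] := pselect (forall q, V q -> t2 q ^+ 2 + t3 q ^+ 2 = 0).
  by exists p => //; exact: rigid_vertical t0.
move=> /existsNP[p1 /not_implyP[Vp1 /eqP q1]].
set V1 := fun q => V q /\ t2 q ^+ 2 + t3 q ^+ 2 != 0.
have V1o : opn V1 by exact: opn_neq0.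
have flow1 : flow V1 by apply: flowS flowV => q [].
have ad1 := flow_adapted V1o flow1 (fun q => @proj2 _ _).
have V1p : V1 p1 by split.
have [a0|] := pselect (forall q, V1 q -> a q = 0).
  by have := a_eq0_absurd smP ad1 d_neq0 V1p a0.
move=> /existsNP[p2 /not_implyP[V1p2 /eqP a2]] {p1 Vp1 q1 V1p}.
set V2 := fun q => V1 q /\ a q != 0.
have V21 q : V2 q -> V1 q by case.
have V2o : opn V2 by apply: opn_neq0 => //; case: flow1.
have flow2 : flow V2 by apply: flowS flow1.
have ad2 := flow_adapted V2o flow2 (fun q V2q => proj2 (V21 q V2q)).
have V2p : V2 p2 by split.
have sk2' : sm V2 k by have [] := ad_sm ad2.
have [k0|] := pselect (forall q, V2 q -> k q = 0).
  have [w0|] := pselect (forall q, V2 q -> w q != 0).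
    by have := geodesic_w_neq0_absurd smP ad2 d_neq0 V2p k0 w0.
  move=> /existsNP[p3 /not_implyP[V2p3 /negP]]; rewrite negbK => /eqP w3.
  exists p3; first by case: V2p3 => -[].
  by apply: (rigid_adapted V2o flow2) => //; [move=> q /V21[]|case: V2p3|exact: k0].
move=> /existsNP[p3 /not_implyP[V2p3 /eqP k3']].
set V3 := fun q => V2 q /\ k q != 0.
have V3o : opn V3 by exact: opn_neq0.
have V32 q : V3 q -> V2 q by case.
have flow3 : flow V3 by apply: flowS flow2.
have ad3 := flow_adapted V3o flow3 (fun q V3q => proj2 (V21 q (V32 q V3q))).
have V3p : V3 p3 by split.
(* T u = v k, so u cannot vanish identically where k has no zero. *)
have [u0|] := pselect (forall q, V3 q -> t1 q = 0).
  have := is_der_congr (adT ad3) u0 (ad_Tu ad3) (is_der_cst smP (adT ad3) 0) V3p.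
  by move=> /eqP; rewrite mulf_eq0 (negbTE (ad_v0 ad3 V3p)) (negbTE (proj2 V3p)).
move=> /existsNP[p4 /not_implyP[V3p4 /eqP u4]].
set V4 := fun q => V3 q /\ t1 q != 0.
have V4o : opn V4 by apply: opn_neq0 => //; have [[]] := flow3.
have V43 q : V4 q -> V3 q by case.
have flow4 : flow V4 by apply: flowS flow3.
have ad4 := flow_adapted V4o flow4 (fun q V4q => proj2 (V21 q (V32 q (V43 q V4q)))).
have V4p : V4 p4 by split.
have [] := generic_absurd smP ad4 d_neq0 _ _ _ V4p.
- by move=> q [[[]]].
- by move=> q [].
- by move=> q [[]].
Qed.

(** Each equation of [rigid] is an equality of functions smooth on all of [U], including the points
    where the adapted frame is undefined; it therefore extends from a dense set. *)
Lemma rigidity U : opn U -> flow U -> forall p, U p -> rigid p.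
Proof.
move=> Uo flowU.
have [[s1 s2 s3] [sk1 sk2 sk3] sa _ _ _ _ _ _ _ _ _ _ _] := flowU.
have [d1 d2 d3 _ _ _] := eP Uo.
have dense f : sm U f -> (forall p, rigid p -> f p = 0) -> forall p, U p -> f p = 0.
  move=> sf rf; apply: dense_zero => // V p Vo VU Vp.
  have [q Vq rq] := rigid_dense Vo (flowS VU flowU) Vp.
  by exists q => //; exact: rf.
have smooth2 f g : sm U f -> sm U g -> (forall p, rigid p -> f p = g p) ->
    forall p, U p -> f p = g p.
  move=> sf sg fg p Up; apply/eqP; rewrite -subr_eq0; apply/eqP.
  apply: (dense (fun p => f p - g p)) => //.
    by apply: (smD smP) => //; exact: smN.
  by move=> q /fg->; rewrite subrr.
have sC := smC smP; have sD := smD smP; have sM := smM smP.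
have sX f n : sm U f -> sm U (fun p => f p ^+ n).
  move=> sf; elim: n => [|n IH]; first exact: sC.
  by apply: (sm_ext smP) (sM _ _ _ sf IH) => q _; rewrite exprS.
have sN := smN smP.
have q1 := der_sm d1; have q2 := der_sm d2; have q3 := der_sm d3.
have sE f : sm U f -> [/\ sm U (e1 f), sm U (e2 f) & sm U (e3 f)] by move=> sf; split; auto.
move=> p Up; split; [move: p Up; apply: dense => // p []//|..]; move: p Up;
  apply: smooth2 => [||p []//].
all: by repeat first [eassumption|apply: (sC)|apply: (sD)|apply: (sM)|apply: (sX)
  |apply: (sN)|by auto].
Qed.

End Density.

(** * Linear algebra of the metric condition *)

Section FlowAlgebra.
Variables (R : realFieldType) (d t1 t2 t3 x11 x12 x13 x21 x22 x23 x31 x32 x33 : R).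

(** [xij] stands for e_i t_j, [Sij] for the Lie derivative of the metric along T, [q] for its
    bilinear form, and ([d1], [d2], [d3]) below for the curl of T. Thus [ki] is S(T, e_i), and [a]
    is - 1/2 <T, curl T>. *)
Let S11 := 2 * x11. Let S22 := 2 * x22. Let S33 := 2 * x33.
Let S12 := x12 + x21 - 2 * d * t3.
Let S13 := x13 + x31 + 2 * d * t2.
Let S23 := x23 + x32.
Let q (a1 a2 a3 b1 b2 b3 : R) := a1 * b1 * S11 + a2 * b2 * S22 + a3 * b3 * S33
  + (a1 * b2 + a2 * b1) * S12 + (a1 * b3 + a3 * b1) * S13 + (a2 * b3 + a3 * b2) * S23.

Hypothesis norm_t : t1 ^+ 2 + t2 ^+ 2 + t3 ^+ 2 = 1.
Hypothesis r1 : t1 * x11 + t2 * x12 + t3 * x13 = 0.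
Hypothesis r2 : t1 * x21 + t2 * x22 + t3 * x23 = 0.
Hypothesis r3 : t1 * x31 + t2 * x32 + t3 * x33 = 0.

Let k1 := t1 * S11 + t2 * S12 + t3 * S13.
Let k2 := t1 * S12 + t2 * S22 + t3 * S23.
Let k3 := t1 * S13 + t2 * S23 + t3 * S33.
Let d1 := x23 - x32 - 2 * t1.
Let d2 := x31 - x13 - (2 + 2 * d) * t2.
Let d3 := x12 - x21 - (2 + 2 * d) * t3.
Let a := - 2^-1 * (t1 * d1 + t2 * d2 + t3 * d3).

Hypothesis q11 : q (1 - t1 * t1) (0 - t1 * t2) (0 - t1 * t3)
  (1 - t1 * t1) (0 - t1 * t2) (0 - t1 * t3) = 0.
Hypothesis q22 : q (0 - t2 * t1) (1 - t2 * t2) (0 - t2 * t3)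
  (0 - t2 * t1) (1 - t2 * t2) (0 - t2 * t3) = 0.
Hypothesis q33 : q (0 - t3 * t1) (0 - t3 * t2) (1 - t3 * t3)
  (0 - t3 * t1) (0 - t3 * t2) (1 - t3 * t3) = 0.
Hypothesis q12 : q (1 - t1 * t1) (0 - t1 * t2) (0 - t1 * t3)
  (0 - t2 * t1) (1 - t2 * t2) (0 - t2 * t3) = 0.
Hypothesis q13 : q (1 - t1 * t1) (0 - t1 * t2) (0 - t1 * t3)
  (0 - t3 * t1) (0 - t3 * t2) (1 - t3 * t3) = 0.
Hypothesis q23 : q (0 - t2 * t1) (1 - t2 * t2) (0 - t2 * t3)
  (0 - t3 * t1) (0 - t3 * t2) (1 - t3 * t3) = 0.

Ltac unfold_all := rewrite /a /k1 /k2 /k3 /q /d1 /d2 /d3 /S11 /S22 /S33 /S12 /S13 /S23.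

(** Q is S(e_i - t_i T, e_j - t_j T), which vanishes since both arguments are orthogonal to T. Its
    expansion contains S(T, T), zero because T has constant length. *)
Let deform ti tj Sij ki kj Q : Q = 0 ->
  Sij - ti * kj - tj * ki + ti * tj * (2 * (t1 * (t1 * x11 + t2 * x12 + t3 * x13) +
    t2 * (t1 * x21 + t2 * x22 + t3 * x23) + t3 * (t1 * x31 + t2 * x32 + t3 * x33))) = Q ->
  Sij = ti * kj + tj * ki.
Proof.
by rewrite r1 r2 r3 !(mulr0, addr0) => -> /eqP; rewrite -addrA -opprD subr_eq0 => /eqP.
Qed.

Lemma deform_rank1 : [/\ S11 = 2 * t1 * k1, S22 = 2 * t2 * k2 & S33 = 2 * t3 * k3] /\
  [/\ S12 = t1 * k2 + t2 * k1, S13 = t1 * k3 + t3 * k1 & S23 = t2 * k3 + t3 * k2].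
Proof.
split; split.
- transitivity (t1 * k1 + t1 * k1); last ring.
  by apply: (deform q11); unfold_all; ring.
- transitivity (t2 * k2 + t2 * k2); last ring.
  by apply: (deform q22); unfold_all; ring.
- transitivity (t3 * k3 + t3 * k3); last ring.
  by apply: (deform q33); unfold_all; ring.
- by apply: (deform q12); unfold_all; ring.
- by apply: (deform q13); unfold_all; ring.
- by apply: (deform q23); unfold_all; ring.
Qed.

Lemma deform_orth : t1 * k1 + t2 * k2 + t3 * k3 = 0.
Proof.
by apply: (lincomb3 (m := 2 * t1) (n := 2 * t2) (k := 2 * t3) r1 r2 r3); unfold_all; ring.
Qed.

Lemma flow_algebra1 : [/\ x11 = t1 * k1, x22 = t2 * k2 & x33 = t3 * k3].
Proof.
have [[E1 E2 E3] _] := deform_rank1.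
by split; [apply: (lincomb1 (m := 2^-1) E1)|apply: (lincomb1 (m := 2^-1) E2)|
  apply: (lincomb1 (m := 2^-1) E3)]; rewrite /S11 /S22 /S33; field.
Qed.

(** [x12] is half the sum of its symmetric part, given by S, and its skew part, given by curl T = -
    2 a T + T x k. The result is the formula nabla_Z T = <T, Z> k + a Z x T; the constants 1 + 2 d
    and 1 are the connection coefficients of the frame. *)
Lemma flow_algebra2 : [/\ x12 = t1 * k2 - a * t3 + (1 + 2 * d) * t3,
  x13 = t1 * k3 + a * t2 - (1 + 2 * d) * t2 & x23 = t2 * k3 - a * t1 + t1].
Proof.
have [_ [E1 E2 E3]] := deform_rank1; split.
- apply: (lincomb4 (m := 2^-1) (n := - 2^-1 * d3) (k := - t1) (l := t2) E1 norm_t r2 r1).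
  by unfold_all; field.
- apply: (lincomb4 (m := 2^-1) (n := 2^-1 * d2) (k := - t1) (l := t3) E2 norm_t r3 r1).
  by unfold_all; field.
- apply: (lincomb4 (m := 2^-1) (n := - 2^-1 * d1) (k := - t2) (l := t3) E3 norm_t r3 r2).
  by unfold_all; field.
Qed.

Lemma flow_algebra3 : [/\ x21 = t2 * k1 + a * t3 - t3,
  x31 = t3 * k1 - a * t2 + t2 & x32 = t3 * k2 + a * t1 - t1].
Proof.
have [_ [E1 E2 E3]] := deform_rank1; split.
- apply: (lincomb4 (m := 2^-1) (n := 2^-1 * d3) (k := t1) (l := - t2) E1 norm_t r2 r1).
  by unfold_all; field.
- apply: (lincomb4 (m := 2^-1) (n := - 2^-1 * d2) (k := t1) (l := - t3) E2 norm_t r3 r1).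
  by unfold_all; field.
- apply: (lincomb4 (m := 2^-1) (n := 2^-1 * d1) (k := t2) (l := - t3) E3 norm_t r3 r2).
  by unfold_all; field.
Qed.
End FlowAlgebra.

(** Here x, y, z, w are the derivatives of F, B, a, t in one direction, and k is the mean curvature
    in that direction. The computation rests on B - 2 d t^2 = 1 + a and 1 - a + 2 A = B. *)
Lemma potential_algebra (R : fieldType) (d a t k x y z w A B F : R) :
  A = a + d * t ^+ 2 -> B = 1 + a + 2 * d * t ^+ 2 -> B != 0 -> F = t / B ->
  z + 2 * d * t * w = 2 * A * k -> (1 + a) * w = - (1 - a) * (t * k) ->
  x * B + F * y = w -> y = z + 2 * d * (2 * t * w) -> x = - F * k.
Proof.
move=> -> BE B0 -> E E' E1 E2; move: B0 E1 E2; rewrite BE => B0 E1 E2; apply: (mulfI B0).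
set b := 1 + a + 2 * d * t ^+ 2 in B0 *.
apply: (lincomb4 (m := - (t / b)) (n := b^-1) (k := 1) (l := - (t / b)) E E' E1 E2).
by rewrite /b; field.
Qed.

(** * Smooth functions *)

Local Notation iterD := Defs.iterD.

Section Smooth.
Variables (R : realType) (E : normedModType R).
Implicit Types (O : set E) (v : E).

Lemma open_eq_near (F : Type) O (f g : E -> F) x : open O -> O x ->
  (forall y, O y -> f y = g y) -> \near x, f x = g x.
Proof.
move=> Oo Ox fg; have := open_nbhs_nbhs (conj Oo Ox).
by apply: filterS => y /fg.
Qed.

Lemma derive_eq_on (F : normedModType R) O (f g : E -> F) x v :
  open O -> O x -> (forall y, O y -> f y = g y) -> 'D_v f x = 'D_v g x.
Proof. by move=> Oo Ox fg; apply: near_eq_derive; exact: open_eq_near fg. Qed.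

Lemma differentiable_eq_on (F : normedModType R) O (f g : E -> F) x :
  open O -> O x -> (forall y, O y -> f y = g y) ->
  differentiable f x -> differentiable g x.
Proof.
move=> Oo Ox fg df.
have nh : \forall h \near (0 : E), f (h + x) = g (h + x).
  have /nbhs0P := open_eq_near Oo Ox fg.
  by apply: filterS => h; rewrite addrC.
have /diff_locallyP[dc dE] := df.
have gE : g \o shift x = cst (g x) + 'd f x +o_ (0 : E) id.
  rewrite -fg//; apply/eqaddoP => e e0; have /eqaddoP/(_ e e0) := dE.
  by apply: filterS2 nh => h fgh; rewrite !fctE /= fgh.
by apply/diff_locallyP; rewrite (diff_unique dc gE).
Qed.

Lemma iterD_eq_on (F : normedModType R) O (f g : E -> F) s x :
  open O -> O x -> (forall y, O y -> f y = g y) -> iterD s f x = iterD s g x.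
Proof.
move=> Oo; elim: s x => [|v s IH] x Ox fg /=; first exact: fg.
by apply: derive_eq_on Oo Ox _ => y Oy; exact: IH.
Qed.

Lemma smooth_on_ext (F : normedModType R) O (f g : E -> F) :
  open O -> (forall y, O y -> f y = g y) -> smooth_on O f -> smooth_on O g.
Proof.
move=> Oo fg fs s x Ox; apply: (differentiable_eq_on Oo Ox _ (fs s x Ox)) => y Oy.
exact: iterD_eq_on Oo Oy fg.
Qed.

Lemma smooth_onS (F : normedModType R) O O' (f : E -> F) :
  O' `<=` O -> smooth_on O f -> smooth_on O' f.
Proof. by move=> O'O fs s x /O'O; exact: fs. Qed.

Lemma smooth_on_iterD (F : normedModType R) O (f : E -> F) s :
  smooth_on O f -> smooth_on O (iterD s f).
Proof.
move=> fs s' x Ox; suff -> : iterD s' (iterD s f) = iterD (s' ++ s) f by exact: fs.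
by elim: s' => //= v s' ->.
Qed.

Lemma smooth_on_derive (F : normedModType R) O (f : E -> F) v :
  smooth_on O f -> smooth_on O (fun x => 'D_v f x).
Proof. exact: (@smooth_on_iterD _ _ _ [:: v]). Qed.

(* The functions obtained from smooth ones by algebraic operations form a class
   closed under directional derivatives, hence they are smooth. *)
Inductive smooth_alg O : (E -> R^o) -> Prop :=
| SmoothAlgBase f : smooth_on O f -> smooth_alg O f
| SmoothAlgCst k : smooth_alg O (fun=> k)
| SmoothAlgD f g : smooth_alg O f -> smooth_alg O g ->
    smooth_alg O (fun x => f x + g x)
| SmoothAlgM f g : smooth_alg O f -> smooth_alg O g ->
    smooth_alg O (fun x => f x * g x)
| SmoothAlgV f : (forall x, O x -> f x != 0) -> smooth_alg O f ->
    smooth_alg O (fun x => (f x)^-1)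
| SmoothAlgSqrt f : (forall x, O x -> 0 < f x) -> smooth_alg O f ->
    smooth_alg O (fun x => Num.sqrt (f x))
| SmoothAlgExt f g : (forall x, O x -> f x = g x) -> smooth_alg O f ->
    smooth_alg O g.

Lemma derive_sqrt_comp (f : E -> R^o) x v : 0 < f x -> differentiable f x ->
  differentiable (fun y => Num.sqrt (f y) : R^o) x /\
  'D_v (fun y => Num.sqrt (f y) : R^o) x = 'D_v f x * (2 * Num.sqrt (f x))^-1.
Proof.
move=> f0 df; have ds : differentiable (Num.sqrt : R -> R) (f x).
  by apply/derivable1_diffP; have [] := is_derive1_sqrt f0.
have dc := differentiable_comp df ds.
split=> //; rewrite deriveE// [X in X v = _](diff_comp df ds)/= deriv1E; last first.
  exact/derivable1_diffP.
by rewrite derive1E derive_sqrt// deriveE.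
Qed.

Lemma smooth_alg_derive O f : open O -> smooth_alg O f ->
  (forall x, O x -> differentiable f x) /\
  (forall v, smooth_alg O (fun x => 'D_v f x)).
Proof.
move=> Oo; elim=> {f} [f fs|k|f g fO [df Df] gO [dg Dg]|f g fO [df Df] gO [dg Dg]|
   f f0 fO [df Df]|f f0 fO [df Df]|f g fg fO [df Df]].
- split=> [x Ox|v]; first exact: (fs [::] x Ox).
  by apply: SmoothAlgBase; exact: smooth_on_derive.
- split=> [x Ox|v]; first exact: differentiable_cst.
  by apply: SmoothAlgExt (SmoothAlgCst O 0) => x _; rewrite derive_cst.
- split=> [x Ox|v]; first exact: differentiableD (df _ Ox) (dg _ Ox).
  apply: SmoothAlgExt (SmoothAlgD (Df v) (Dg v)) => x Ox.
  by rewrite -(deriveD (diff_derivable (df x Ox)) (diff_derivable (dg x Ox))).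
- split=> [x Ox|v]; first exact: differentiableM (df _ Ox) (dg _ Ox).
  apply: SmoothAlgExt (SmoothAlgD (SmoothAlgM fO (Dg v)) (SmoothAlgM gO (Df v)))
    => x Ox.
  by rewrite -(deriveM (diff_derivable (df x Ox)) (diff_derivable (dg x Ox))).
- split=> [x Ox|v]; first exact: differentiableV (df _ Ox) (f0 _ Ox).
  have h := SmoothAlgV f0 fO.
  apply: SmoothAlgExt (SmoothAlgM (SmoothAlgCst O (-1))
    (SmoothAlgM (SmoothAlgM h h) (Df v))) => x Ox.
  rewrite [RHS](deriveV (f0 x Ox) (diff_derivable (df x Ox))).
  by rewrite mulN1r scaleNr -invfM -expr2.
- split=> [x Ox|v]; first by have [] := derive_sqrt_comp 0 (f0 _ Ox) (df _ Ox).
  have h := SmoothAlgSqrt f0 fO.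
  have n0 x : O x -> 2 * Num.sqrt (f x) != 0.
    by move=> /f0 fx; rewrite mulf_neq0 ?pnatr_eq0// gt_eqF// sqrtr_gt0.
  apply: SmoothAlgExt (SmoothAlgM (Df v)
    (SmoothAlgV n0 (SmoothAlgM (SmoothAlgCst O 2) h))) => x Ox.
  by have [_ ->] := derive_sqrt_comp v (f0 _ Ox) (df _ Ox).
- split=> [x Ox|v]; first exact: differentiable_eq_on Oo Ox fg (df x Ox).
  by apply: SmoothAlgExt (Df v) => x Ox; exact: derive_eq_on Oo Ox fg.
Qed.

Lemma smooth_algP O f : open O -> smooth_alg O f -> smooth_on O f.
Proof.
move=> Oo fO s; suff : smooth_alg O (iterD s f).
  by move=> /(smooth_alg_derive Oo)[+ _]; apply.
by elim: s => //= v s /(smooth_alg_derive Oo)[_]; apply.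
Qed.

End Smooth.

(** * Symmetry of second derivatives *)

Section Schwarz.
Variables (R : realType) (E : normedModType R).

Lemma is_derive_line (f : E -> R^o) (x v : E) (t : R) :
  differentiable f (x + t *: v) ->
  is_derive (t : R^o) 1 (fun s : R => f (x + s *: v)) ('D_v f (x + t *: v)).
Proof.
move=> /(@diff_derivable _ _ _ _ _ v) df.
have E1 : (fun h : R => h^-1 *: (f (x + (h *: (1 : R^o) + t) *: v) - f (x + t *: v))) =
          (fun h : R => h^-1 *: ((f \o shift (x + t *: v)) (h *: v) - f (x + t *: v))).
  apply/funext => h /=; congr (_ *: (f _ - _)).
  by rewrite [h *: _]mulr1 scalerDl addrCA.
by split; rewrite /derivable /derive /= E1.
Qed.

Lemma mvt_cc (g dg : R -> R) (h : R) : 0 < h ->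
  (forall s : R, 0 <= s <= h -> is_derive (s : R^o) 1 g (dg s)) ->
  exists2 s, 0 <= s <= h & g h - g 0 = h * dg s.
Proof.
move=> h0 gd; have [|s|s] := @MVT R g dg 0 h h0.
- by move=> s; rewrite in_itv/= => /andP[s0 sh]; apply: gd; rewrite !ltW.
- apply: derivable_within_continuous => t; rewrite in_itv/= => th.
  by have [] := gd t th.
- rewrite in_itv/= subr0 mulrC => /andP[s0 sh] ->; exists s => //.
  by rewrite !ltW.
Qed.

(** The mean value theorem is applied to s |-> f (x + h w + s v) - f (x + s v), then to the
    derivative of f along v on a segment of direction w. The second difference on the left is
    symmetric in v and w. *)
Lemma square_mvt (O : set E) (f : E -> R^o) (x v w : E) (h : R) : 0 < h ->
  (forall s t, 0 <= s <= h -> 0 <= t <= h -> O (x + s *: v + t *: w)) ->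
  (forall y, O y -> differentiable f y) ->
  (forall y, O y -> differentiable (fun z => 'D_v f z) y) ->
  exists s t, [/\ 0 <= s <= h, 0 <= t <= h &
    f (x + h *: v + h *: w) - f (x + h *: v) - f (x + h *: w) + f x =
    h ^+ 2 * 'D_w (fun z => 'D_v f z) (x + s *: v + t *: w)].
Proof.
move=> h0 xO df ddf.
have hh : 0 <= h <= h by rewrite lexx ltW.
have h00 : 0 <= (0 : R) <= h by rewrite lexx ltW.
have dl s : 0 <= s <= h -> is_derive (s : R^o) 1
    (fun s : R => f (x + h *: w + s *: v) - f (x + s *: v) : R)
    ('D_v f (x + h *: w + s *: v) - 'D_v f (x + s *: v)).
  move=> sh; apply: is_deriveB; apply: is_derive_line; apply: df.
    by rewrite addrAC; exact: xO.
  by have := xO s 0 sh h00; rewrite scale0r addr0.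
have [s s01] := mvt_cc h0 dl.
rewrite !scale0r !addr0 => E1.
have dm t : 0 <= t <= h -> is_derive (t : R^o) 1
    (fun t : R => 'D_v f (x + s *: v + t *: w) : R)
    ('D_w (fun z => 'D_v f z) (x + s *: v + t *: w)).
  by move=> th; apply: (@is_derive_line (fun z => 'D_v f z)); apply: ddf; exact: xO.
have [t t01] := mvt_cc h0 dm.
rewrite scale0r addr0 => E2.
exists s, t; split => //; rewrite expr2 -mulrA -E2.
rewrite [x + s *: v + h *: w]addrAC -E1 [x + h *: v + h *: w]addrAC.
by rewrite opprB addrA [LHS]addrAC.
Qed.

(** The second difference over one small square, computed in both orders, equates the two mixed
    derivatives at two points of the square; by continuity each is within e / 2 of its value at
    x. *)
Lemma derive_sym (O : set E) (f : E -> R^o) (x v w : E) : open O -> O x ->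
  smooth_on O f ->
  'D_w (fun z => 'D_v f z) x = 'D_v (fun z => 'D_w f z) x.
Proof.
move=> Oo Ox fs; apply/eqP; rewrite -subr_eq0 -normr_le0 leNgt; apply/negP => e0.
set e := `|_| in e0.
have cont u1 u2 : {for x, continuous (fun y => 'D_u1 (fun z => 'D_u2 f z) y : R^o)}.
  apply: differentiable_continuous; exact: (fs [:: u1; u2] x Ox).
have e20 : 0 < e / 2 by rewrite divr_gt0.
have /cvgrPdist_lt/(_ _ e20) near1 := cont w v.
have /cvgrPdist_lt/(_ _ e20) near2 := cont v w.
have near3 := open_nbhs_nbhs (conj Oo Ox).
have [r r0 rP] := (nbhs_ballP _ _).1 (filterI near3 (filterI near1 near2)).
have c0 : 0 < `|v| + `|w| + 1 by rewrite ltr_wpDl ?addr_ge0.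
pose h := r / 2 / (`|v| + `|w| + 1).
have h0 : 0 < h by rewrite !divr_gt0.
have inball s t : 0 <= s <= h -> 0 <= t <= h -> ball x r (x + s *: v + t *: w).
  move=> /andP[s0 sh] /andP[t0 th]; rewrite -ball_normE /ball_/=.
  rewrite -addrA opprD addNKr opprD -opprD normrN.
  apply: le_lt_trans (ler_normD _ _) _; rewrite !normrZ !ger0_norm//.
  apply: (@le_lt_trans _ _ (h * (`|v| + `|w| + 1))).
    by rewrite !mulrDr mulr1 ler_wpDr ?(ltW h0)// lerD// ler_wpM2r.
  by rewrite /h divfK ?gt_eqF// ltr_pdivrMr// ltr_pMr// ltr1n.
have d0 y : O y -> differentiable f y by exact: (fs [::]).
have d1 u y : O y -> differentiable (fun z => 'D_u f z) y by exact: (fs [:: u]).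
have [a [b [s01 t01 E1]]] := square_mvt h0
  (fun s t sh th => (rP _ (inball s t sh th)).1) d0 (d1 v).
have inball' s t : 0 <= s <= h -> 0 <= t <= h -> ball x r (x + s *: w + t *: v).
  by move=> sh th; rewrite addrAC; exact: inball.
have [a' [b' [s'01 t'01 E2]]] := square_mvt h0
  (fun s t sh th => (rP _ (inball' s t sh th)).1) d0 (d1 w).
have E3 : 'D_w (fun z => 'D_v f z) (x + a *: v + b *: w) =
          'D_v (fun z => 'D_w f z) (x + a' *: w + b' *: v).
  have h20 : h ^+ 2 != 0 by rewrite expf_neq0// gt_eqF.
  apply: (mulfI h20); rewrite -E1 -E2 [x + h *: w + h *: v]addrAC.
  by congr (_ + _); exact: addrAC.
have [_ [+ _]] := rP _ (inball _ _ s01 t01).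
have [_ [_ +]] := rP _ (inball' _ _ s'01 t'01).
rewrite /= E3 => BC AC; have := ltrD AC BC.
rewrite -splitr [X in _ + X]distrC => /(le_lt_trans (ler_distD _ _ _)).
by rewrite ltxx.
Qed.

End Schwarz.

(** * Calculus on the sphere *)

Section Sphere.
Variable R : realType.
Local Notation R4 := 'rV[R]_4.
Implicit Types (p x v : R4) (V : set R4) (f : R4 -> R^o).

Lemma smooth_alg_sum (I : Type) (r : seq I) (O : set R4) (F : I -> R4 -> R^o) :
  (forall i, smooth_alg O (F i)) -> smooth_alg O (fun x => \sum_(i <- r) F i x).
Proof.
move=> FO; elim: r => [|i r IH].
  by apply: SmoothAlgExt (SmoothAlgCst O 0) => x _; rewrite big_nil.
by apply: SmoothAlgExt (SmoothAlgD (FO i) IH) => x _; rewrite big_cons.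
Qed.

Lemma derive_coord v x (i : 'I_4) : 'D_v (fun y : R4 => y ord0 i : R^o) x = v ord0 i.
Proof.
have := @derive_mx _ _ 1 4 (@id R4) x v (@derivable_id _ _ x v).
by rewrite derive_id => /(congr1 (fun M : R4 => M ord0 i)); rewrite mxE => ->.
Qed.

Lemma smooth_coord (O : set R4) i : smooth_alg O (fun x : R4 => x ord0 i : R^o).
Proof.
apply: SmoothAlgBase => s x _.
suff [->|[k ->]] : iterD s (fun x : R4 => x ord0 i : R^o) = (fun x => x ord0 i) \/
    exists k, iterD s (fun x : R4 => x ord0 i : R^o) = fun=> k.
- exact: differentiable_coord.
- exact: differentiable_cst.
elim: s => [|v s [/= ->|[k /= ->]]]; [by left|right..].
  by exists (v ord0 i); apply/funext => y; exact: derive_coord.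
by exists 0; apply/funext => y; exact: derive_cst.
Qed.

Lemma derive_sum_coord f v x : differentiable f x ->
  'D_v f x = \sum_i v ord0 i * 'D_('e_i) f x.
Proof.
move=> df; rewrite deriveE// [in LHS](row_sum_delta v) linear_sum.
by apply: eq_bigr => i _; rewrite linearZ deriveE.
Qed.

Lemma dot_ge0 x : 0 <= dot x x.
Proof. by apply: sumr_ge0 => i _; rewrite -expr2 sqr_ge0. Qed.

Lemma dot_gt0 x : x != 0 -> 0 < dot x x.
Proof.
move=> x0; rewrite lt_def dot_ge0 andbT; apply: contra x0 => /eqP d0.
apply/eqP/rowP => i; rewrite mxE; apply/eqP; rewrite -sqrf_eq0 expr2.
have := psumr_eq0P (fun j _ => _ : 0 <= x ord0 j * x ord0 j) d0.
by move=> -> // j; rewrite -expr2 sqr_ge0.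
Qed.

Lemma dotZ a b x y : dot (a *: x) (b *: y) = a * b * dot x y :> R.
Proof. by rewrite mulr_sumr; apply: eq_bigr => i _; rewrite !mxE mulrACA. Qed.

Lemma radialZ a x : 0 < a -> radial (a *: x) = radial x.
Proof.
move=> a0; rewrite /radial dotZ -expr2 sqrtrM ?sqr_ge0// sqrtr_sqr gtr0_norm//.
by rewrite invfM scalerA mulrAC mulVf ?mul1r// gt_eqF.
Qed.

Lemma radial_sphere x : x != 0 -> sphere3 (radial x).
Proof.
move=> /dot_gt0 d0; rewrite /sphere3/= /radial dotZ -invfM -expr2 sqr_sqrtr ?ltW//.
by rewrite mulVf// gt_eqF.
Qed.

Lemma sphere_radial p : sphere3 p -> radial p = p.
Proof. by rewrite /sphere3/= /radial => ->; rewrite sqrtr1 invr1 scale1r. Qed.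

Lemma sphere_neq0 p : sphere3 p -> p != 0.
Proof.
apply: contraPneq => ->; rewrite /sphere3/= /dot big1 => [/eqP|i _].
  by rewrite eq_sym oner_eq0.
by rewrite mxE mul0r.
Qed.

Definition cone V : set R4 := [set x | x != 0 /\ V (radial x)].

Lemma sphere_openP V p : sphere_open V -> V p -> sphere3 p.
Proof. by case=> O _ -> []. Qed.

Lemma cone_sphere V p : sphere_open V -> V p -> cone V p.
Proof.
move=> Vo Vp; have sp := sphere_openP Vo Vp.
by split; [exact: sphere_neq0|rewrite sphere_radial].
Qed.

Lemma smooth_alg_dot (O : set R4) : smooth_alg O (fun x : R4 => dot x x : R^o).
Proof. by apply: smooth_alg_sum => i; apply: SmoothAlgM; exact: smooth_coord. Qed.

Lemma smooth_alg_norm (O : set R4) : (forall x, O x -> x != 0) ->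
  smooth_alg O (fun x : R4 => (Num.sqrt (dot x x))^-1 : R^o).
Proof.
move=> O0; apply: SmoothAlgV => [x /O0 /dot_gt0 d0|].
  by rewrite gt_eqF// sqrtr_gt0.
by apply: SmoothAlgSqrt (smooth_alg_dot O) => x /O0 /dot_gt0.
Qed.

Lemma open_neq0 : open [set x : R4 | x != 0].
Proof.
rewrite openE => x /= x0; apply/nbhs_ballP; exists `|x|; first by rewrite /= normr_gt0.
move=> y; rewrite -ball_normE/= => xy; apply/eqP => y0.
by move: xy; rewrite y0 subr0 ltxx.
Qed.

Lemma radial_continuous x : x != 0 -> {for x, continuous (@radial R)}.
Proof.
move=> x0; apply: differentiable_continuous.
apply: (@differentiable_eq_on _ _ _ [set x : R4 | x != 0]
  (fun y => \sum_i ((Num.sqrt (dot y y))^-1 * y ord0 i) *: ('e_i : R4))) => //.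
- exact: open_neq0.
- move=> y _; rewrite /radial; set c := _^-1; rewrite [in RHS](row_sum_delta y).
  by rewrite scaler_sumr; apply: eq_bigr => i _; rewrite scalerA.
rewrite -fct_sumE; apply: differentiable_sum => i; apply: differentiableZl.
have [+ _] := smooth_alg_derive open_neq0
  (SmoothAlgM (@smooth_alg_norm [set x | x != 0] (fun _ => id)) (smooth_coord _ i)).
exact.
Qed.

Lemma cone_open V : sphere_open V -> open (cone V).
Proof.
case=> O Oo ->; rewrite openE => x [x0 [_ Ox]]; rewrite /interior.
have H : \forall y \near x, O (radial y) := radial_continuous x0 (open_nbhs_nbhs (conj Oo Ox)).
have := open_nbhs_nbhs (conj open_neq0 (x0 : [set x | x != 0] x)).
move: H; apply: filterS2 => y Oy /= y0; split=> //; split=> //; exact: radial_sphere.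
Qed.

(* On open [V] this is [sphere_smooth V f] (lemma [smP]); quantifying over the open
   subsets of [V] makes extensionality hold for every [V]. *)
Definition sm V f : Prop :=
  forall W, sphere_open W -> W `<=` V -> sphere_smooth W f.

Lemma smP V f : sphere_open V -> sm V f <-> sphere_smooth V f.
Proof.
move=> Vo; split=> [|fs W Wo WV]; first exact.
by apply: smooth_onS fs => x [x0 /WV].
Qed.

Lemma sm_alg V f : sphere_open V -> sm V f <-> smooth_alg (cone V) (f \o @radial R).
Proof.
move=> Vo; have Co := cone_open Vo; rewrite smP//; split => [|/(smooth_algP Co)//].
exact: SmoothAlgBase.
Qed.

Lemma smooth_sheaf_sphere : smooth_sheaf sm.
Proof.
split.
- by move=> V W f WV fs U Uo UW; apply: fs => // q /UW/WV.
- move=> V f g fg fs W Wo WV; apply: smooth_on_ext (fs W Wo WV); first exact: cone_open.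
  by move=> y [_ /WV/fg].
- move=> V k W Wo WV; apply/smP/sm_alg => //; exact: SmoothAlgCst.
- move=> V f g fs gs W Wo WV; apply/smP/sm_alg => //.
  by apply: SmoothAlgD; apply: SmoothAlgBase; [exact: fs|exact: gs].
- move=> V f g fs gs W Wo WV; apply/smP/sm_alg => //.
  by apply: SmoothAlgM; apply: SmoothAlgBase; [exact: fs|exact: gs].
- move=> V f f0 fs W Wo WV; apply/smP/sm_alg => //.
  by apply: SmoothAlgV => [x [_ /WV/f0]//|]; apply: SmoothAlgBase; exact: fs.
- move=> V f f0 fs W Wo WV; apply/smP/sm_alg => //.
  by apply: SmoothAlgSqrt => [x [_ /WV/f0]//|]; apply: SmoothAlgBase; exact: fs.
Qed.

Lemma sphere_open_neq0 V f : sphere_open V -> sm V f ->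
  sphere_open (fun p => V p /\ f p != 0).
Proof.
move=> Vo fs; exists [set x | cone V x /\ f (radial x) != 0]; last first.
  apply/seteqP; split=> p /=.
    move=> [Vp fp]; have sp := sphere_openP Vo Vp.
    split=> //; split; first exact: cone_sphere Vp.
    by rewrite sphere_radial.
  by move=> [sp [[_]]]; rewrite sphere_radial.
rewrite openE => x [Cx fx]; rewrite /interior.
have [+ _] := smooth_alg_derive (cone_open Vo) ((sm_alg f Vo).1 fs).
move=> /(_ x Cx)/differentiable_continuous.
move=> /(_ _ (open_nbhs_nbhs (conj (open_neq (y := 0 : R)) (fx : [set r | r != 0] _)))) H.
have {}H : \forall y \near x, f (radial y) != 0 := H.
have := open_nbhs_nbhs (conj (cone_open Vo) Cx).
by move: H; apply: filterS2 => y.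
Qed.


(** The extension along rays is homogeneous of degree 0, so both difference quotients coincide. *)
Lemma derive_homog (F : normedModType R) (f : R4 -> F) a x v : 0 < a ->
  'D_(a *: v) (f \o @radial R) (a *: x) = 'D_v (f \o @radial R) x.
Proof.
move=> a0; set g := f \o @radial R.
have E1 : (fun h : R => h^-1 *: ((g \o shift (a *: x)) (h *: (a *: v)) - g (a *: x))) =
          (fun h : R => h^-1 *: ((g \o shift x) (h *: v) - g x)).
  apply/funext => h; rewrite /g/= scalerA [h * a]mulrC -scalerA -scalerDr.
  by rewrite !radialZ.
by rewrite /derive E1.
Qed.

Implicit Types K H : {linear R4 -> R4}.

(* For linear [K], differentiating along [K] commutes with the extension along rays
   (lemma [lie_radial]), so that [lie K] can be iterated. *)
Definition lie K f p : R := 'D_(K p) (f \o @radial R) p.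

Lemma lie_radial K f x : x != 0 -> lie K f (radial x) = 'D_(K x) (f \o @radial R) x.
Proof.
by move=> x0; rewrite /lie linearZ derive_homog// invr_gt0 sqrtr_gt0 dot_gt0.
Qed.

Lemma linear_coord K x i : K x ord0 i = \sum_j x ord0 j * K 'e_j ord0 i.
Proof.
rewrite {1}(row_sum_delta x) linear_sum summxE; apply: eq_bigr => j _.
by rewrite linearZ mxE.
Qed.

Lemma smooth_alg_linear K (O : set R4) i : smooth_alg O (fun x => K x ord0 i : R^o).
Proof.
apply: (@SmoothAlgExt _ _ _ (fun x => \sum_j x ord0 j * K 'e_j ord0 i)).
  by move=> x _; rewrite [RHS]linear_coord.
by apply: smooth_alg_sum => j; apply: SmoothAlgM; [exact: smooth_coord|exact: SmoothAlgCst].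
Qed.

Lemma derive_linear K v x i : 'D_v (fun y => K y ord0 i : R^o) x = K v ord0 i.
Proof.
rewrite linear_coord.
rewrite (_ : (fun y => K y ord0 i : R^o) =
    \sum_j ((fun y : R4 => y ord0 j : R^o) * cst (K 'e_j ord0 i))); last first.
  by apply/funext => y; rewrite fct_sumE [LHS]linear_coord.
have dc j : derivable (fun y : R4 => y ord0 j : R^o) x v.
  by apply: diff_derivable; exact: differentiable_coord.
rewrite derive_sum => [|j]; last exact: derivableM.
apply: eq_bigr => j _; rewrite deriveM// derive_cst derive_coord scaler0 add0r.
exact: mulrC.
Qed.


End Sphere.

(** * Derivations defined by linear vector fields *)

Section Lie.
Variable R : realType.
Local Notation R4 := 'rV[R]_4.
Implicit Types (p x v : R4) (V : set R4) (f : R4 -> R^o) (K H : {linear R4 -> R4}).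

Lemma sm_smooth V f : sphere_open V -> sm V f -> smooth_on (cone V) (f \o @radial R).
Proof. by move=> Vo fs; exact: fs. Qed.

Lemma sm_diff V f x : sphere_open V -> sm V f -> cone V x ->
  differentiable (f \o @radial R) x.
Proof. by move=> Vo fs; exact: (sm_smooth Vo fs [::]). Qed.

(** Off the sphere as well, [lie K f] is a first-order operator with linear coefficients applied to
    the extension of f. This yields its smoothness and its further derivatives. *)
Lemma lie_cone V K f x : sphere_open V -> sm V f -> cone V x ->
  lie K f (radial x) = \sum_i K x ord0 i * 'D_('e_i) (f \o @radial R) x.
Proof.
move=> Vo fs Cx; have [x0 _] := Cx; rewrite lie_radial// derive_sum_coord//.
exact: sm_diff Cx.
Qed.

Lemma lie_sm V K f : sphere_open V -> sm V f -> sm V (lie K f : R4 -> R^o).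
Proof.
move=> Vo fs; apply/sm_alg => //.
apply: (@SmoothAlgExt _ _ _ (fun x => \sum_i K x ord0 i * 'D_('e_i) (f \o @radial R) x)).
  by move=> x Cx; rewrite /= (lie_cone K Vo fs Cx).
apply: smooth_alg_sum => i; apply: SmoothAlgM; first exact: smooth_alg_linear.
by apply: SmoothAlgBase; apply: smooth_on_derive; exact: sm_smooth.
Qed.

Lemma lie_derivation V K : sphere_open V -> derivation (@sm R) V (lie K).
Proof.
move=> Vo; split.
- by move=> f fs; exact: lie_sm.
- move=> f g fg p Vp; apply: derive_eq_on (cone_open Vo) (cone_sphere Vo Vp) _.
  by move=> y [_ /fg].
- by move=> k p Vp; rewrite /lie; exact: derive_cst.
- move=> f g fs gs p Vp; have Cp := cone_sphere Vo Vp.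
  have df := diff_derivable (v := K p) (sm_diff Vo fs Cp).
  have dg := diff_derivable (v := K p) (sm_diff Vo gs Cp).
  exact: deriveD df dg.
- move=> f g fs gs p Vp; have Cp := cone_sphere Vo Vp.
  have df := diff_derivable (v := K p) (sm_diff Vo fs Cp).
  have dg := diff_derivable (v := K p) (sm_diff Vo gs Cp).
  have := deriveM df dg; rewrite /= sphere_radial; last exact: sphere_openP Vp.
  move=> E; rewrite /lie; transitivity (f p *: 'D_(K p) (g \o @radial R) p +
     g p *: 'D_(K p) (f \o @radial R) p); first exact: E.
  by rewrite addrC; congr (_ + _); exact: mulrC.
Qed.

Lemma lie_lie V H K f p : sphere_open V -> sm V f -> V p ->
  lie H (lie K f) p = 'D_(K (H p)) (f \o @radial R) p +
   \sum_i \sum_j K p ord0 i * H p ord0 j *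
     'D_('e_j) (fun x => 'D_('e_i) (f \o @radial R) x) p.
Proof.
move=> Vo fs Vp; have Cp := cone_sphere Vo Vp; have Co := cone_open Vo.
have sf := sm_smooth Vo fs.
pose k i : R4 -> R^o := fun x => K x ord0 i.
pose d i : R4 -> R^o := fun x => 'D_('e_i) (f \o @radial R) x.
have dk i : derivable (k i) p (H p).
  apply: diff_derivable.
  by have [+ _] := smooth_alg_derive (@openT R4) (smooth_alg_linear K setT i); apply.
have dd i : differentiable (d i) p by apply: (sf [:: 'e_i]).
have dd' i : derivable (d i) p (H p) by apply: diff_derivable.
have -> : lie H (lie K f) p = 'D_(H p) (\sum_i (k i * d i)) p.
  apply: derive_eq_on Co Cp _ => x Cx; rewrite /= (lie_cone K Vo fs Cx).
  by rewrite fct_sumE.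
rewrite derive_sum => [|i]; last exact: derivableM.
rewrite derive_sum_coord; last exact: sm_diff Cp.
rewrite -big_split; apply: eq_bigr => i _ /=; rewrite deriveM// [LHS]addrC.
have -> : 'D_(H p) (k i) p = K (H p) ord0 i by exact: derive_linear.
congr (_ + _); first exact: mulrC.
rewrite derive_sum_coord// scaler_sumr; apply: eq_bigr => j _.
by rewrite -mulrA.
Qed.

(** The second-order terms cancel by symmetry; what remains is the bracket of two linear fields,
    again a linear field. *)
Lemma lie_comm V H K f p : sphere_open V -> sm V f -> V p ->
  lie H (lie K f) p - lie K (lie H f) p =
  'D_(K (H p) - H (K p)) (f \o @radial R) p.
Proof.
move=> Vo fs Vp; have Cp := cone_sphere Vo Vp; have Co := cone_open Vo.
have sf := sm_smooth Vo fs; have df := sm_diff Vo fs Cp.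
have sym : \sum_i \sum_j K p ord0 i * H p ord0 j *
     'D_('e_j) (fun x => 'D_('e_i) (f \o @radial R) x) p =
   \sum_i \sum_j H p ord0 i * K p ord0 j *
     'D_('e_j) (fun x => 'D_('e_i) (f \o @radial R) x) p.
  rewrite exchange_big /=; apply: eq_bigr => i _; apply: eq_bigr => j _.
  have -> := @derive_sym R _ (cone V) (f \o @radial R) p 'e_i 'e_j Co Cp sf.
  by rewrite [K p _ _ * _]mulrC.
rewrite (lie_lie H K Vo fs Vp) (lie_lie K H Vo fs Vp) sym.
rewrite opprD addrACA subrr addr0 !deriveE//.
by rewrite -linearB.
Qed.

End Lie.

(** * The left-invariant frame *)

Section Quaternions.
Variable R : realType.
Local Notation R4 := 'rV[R]_4.
Implicit Types (p u v : R4).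

Definition co p (i : nat) : R := p ord0 (inord i).

(* In quaternions, [hopf_field], [jfield] and [jfield \o hopf_field] are the left
   multiplications by i, j and ji = - k. *)
Definition jfield p : R4 :=
  \row_i [:: - co p 2; co p 3; co p 0; - co p 1]`_i.

Lemma hopf_linear : linear (@hopf_field R).
Proof.
move=> a u v; apply/rowP => -[[|[|[|[|//]]]] i4]; rewrite !mxE/= ?mxE//; ring.
Qed.
HB.instance Definition _ := GRing.isLinear.Build R R4 R4 _ (@hopf_field R) hopf_linear.

Lemma jfield_linear : linear jfield.
Proof.
move=> a u v; apply/rowP => -[[|[|[|[|//]]]] i4]; rewrite !mxE/= /co ?mxE//; ring.
Qed.
HB.instance Definition _ := GRing.isLinear.Build R R4 R4 _ jfield jfield_linear.

Lemma coP u v : (forall i, (i < 4)%N -> co u i = co v i) -> u = v.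
Proof.
move=> uv; apply/rowP => i; have := uv i (ltn_ord i).
by rewrite /co inord_val.
Qed.

Lemma coD u v i : co (u + v) i = co u i + co v i. Proof. by rewrite /co mxE. Qed.
Lemma coZ a u i : co (a *: u) i = a * co u i. Proof. by rewrite /co mxE. Qed.
Lemma coN u i : co (- u) i = - co u i. Proof. by rewrite /co mxE. Qed.

Lemma co_hopf p : [/\ co (hopf_field p) 0 = - co p 1, co (hopf_field p) 1 = co p 0,
  co (hopf_field p) 2 = - co p 3 & co (hopf_field p) 3 = co p 2].
Proof. by split; rewrite /co mxE inordK. Qed.

Lemma co_j p : [/\ co (jfield p) 0 = - co p 2, co (jfield p) 1 = co p 3,
  co (jfield p) 2 = co p 0 & co (jfield p) 3 = - co p 1].
Proof. by split; rewrite {1}/co mxE inordK. Qed.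

Definition coE := (coD, coZ, coN, fun p => let: And4 a b c d := co_hopf p in (a, b, c, d),
  fun p => let: And4 a b c d := co_j p in (a, b, c, d)).

Lemma dotE u v : dot u v =
  co u 0 * co v 0 + co u 1 * co v 1 + co u 2 * co v 2 + co u 3 * co v 3.
Proof.
rewrite /dot !big_ord_recl big_ord0 addr0 !addrA /co.
by do ?[congr (_ + _)]; congr (u _ _ * v _ _); apply: val_inj; rewrite /= ?inordK.
Qed.

(** p and its three images form an orthonormal basis of the Euclidean space, and u has no component
    on p. *)
Lemma parseval p u v : sphere3 p -> tangent p u ->
  dot u v = dot u (hopf_field p) * dot v (hopf_field p) +
   dot u (jfield p) * dot v (jfield p) +
   dot u (jfield (hopf_field p)) * dot v (jfield (hopf_field p)).
Proof.
rewrite /sphere3/= /tangent/= !dotE !coE => p1 pu.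
apply: (lincomb2
  (m := - (co u 0 * co v 0 + co u 1 * co v 1 + co u 2 * co v 2 + co u 3 * co v 3))
  (n := co p 0 * co v 0 + co p 1 * co v 1 + co p 2 * co v 2 + co p 3 * co v 3) p1 pu).
ring.
Qed.

End Quaternions.

(** * Orthonormal frame of the Berger metric *)

Section Berger.
Variables (R : realType) (eps : R).
Local Notation R4 := 'rV[R]_4.
Implicit Types (p u v : R4) (V U : set R4) (f : R4 -> R^o).
Hypothesis eps_gt0 : 0 < eps.

(** For the Berger metric the Hopf field has length eps and the two horizontal fields have length
    sqrt eps. Writing 1 / eps = 1 + d, the structure constants become 2 + 2 d, 2 + 2 d and 2. *)
Definition frame1 p : R4 := eps^-1 *: hopf_field p.
Definition frame2 p : R4 := (Num.sqrt eps)^-1 *: jfield p.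
Definition frame3 p : R4 := (Num.sqrt eps)^-1 *: jfield (hopf_field p).

Lemma frame1_linear : linear frame1.
Proof. by move=> a u v; rewrite /frame1 hopf_linear scalerDr !scalerA mulrC. Qed.
Lemma frame2_linear : linear frame2.
Proof. by move=> a u v; rewrite /frame2 jfield_linear scalerDr !scalerA mulrC. Qed.
Lemma frame3_linear : linear frame3.
Proof. by move=> a u v; rewrite /frame3 hopf_linear jfield_linear scalerDr !scalerA mulrC. Qed.
HB.instance Definition _ := GRing.isLinear.Build R R4 R4 _ frame1 frame1_linear.
HB.instance Definition _ := GRing.isLinear.Build R R4 R4 _ frame2 frame2_linear.
HB.instance Definition _ := GRing.isLinear.Build R R4 R4 _ frame3 frame3_linear.

Let s := (Num.sqrt eps)^-1.
Let d := eps^-1 - 1.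
Local Notation e1 := (lie frame1).
Local Notation e2 := (lie frame2).
Local Notation e3 := (lie frame3).

Lemma hopfZ a p : hopf_field (a *: p) = a *: hopf_field p :> R4.
Proof. exact: linearZ. Qed.

Lemma jfieldZ a p : jfield (a *: p) = a *: jfield p :> R4.
Proof. exact: linearZ. Qed.

Lemma s_sqr : s * s = eps^-1.
Proof. by rewrite -invfM -expr2 sqr_sqrtr// ltW. Qed.

Lemma eps_neq0 : eps != 0. Proof. by rewrite gt_eqF. Qed.

Lemma frame12 p : frame2 (frame1 p) - frame1 (frame2 p) = (2 + 2 * d) *: frame3 p.
Proof.
by apply: coP => -[|[|[|[|//]]]] _;
  rewrite /frame1 /frame2 /frame3 -/s !(hopfZ, jfieldZ, coN, coE)/= /d; ring.
Qed.

Lemma frame13 p : frame3 (frame1 p) - frame1 (frame3 p) = - (2 + 2 * d) *: frame2 p.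
Proof.
by apply: coP => -[|[|[|[|//]]]] _;
  rewrite /frame1 /frame2 /frame3 -/s !(hopfZ, jfieldZ, coN, coE)/= /d; ring.
Qed.

Lemma frame23 p : frame3 (frame2 p) - frame2 (frame3 p) = 2 *: frame1 p.
Proof.
by apply: coP => -[|[|[|[|//]]]] _;
  rewrite /frame1 /frame2 /frame3 -/s -s_sqr !(hopfZ, jfieldZ, coN, coE)/=; ring.
Qed.

Lemma lie_scale V a f p w : sphere_open V -> sm V f -> V p ->
  'D_(a *: w) (f \o @radial R) p = a * 'D_w (f \o @radial R) p.
Proof.
move=> Vo fs Vp; have df := sm_diff Vo fs (cone_sphere Vo Vp).
by rewrite !deriveE// linearZ.
Qed.

Lemma berger_frameP V : sphere_open V -> berger_frame (@sm R) d e1 e2 e3 V.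
Proof.
move=> Vo; split; [exact: lie_derivation|exact: lie_derivation|exact: lie_derivation|..].
- by move=> f p fs Vp; rewrite (lie_comm _ _ Vo fs Vp) frame12 (lie_scale _ _ Vo fs Vp).
- by move=> f p fs Vp; rewrite (lie_comm _ _ Vo fs Vp) frame13 (lie_scale _ _ Vo fs Vp).
- by move=> f p fs Vp; rewrite (lie_comm _ _ Vo fs Vp) frame23 (lie_scale _ _ Vo fs Vp).
Qed.

(** Berger inner products with the frame: eps^2 / eps = eps in the vertical direction, eps / sqrt
    eps = sqrt eps in the horizontal ones. *)
Definition cmp1 p u : R := eps * dot u (hopf_field p).
Definition cmp2 p u : R := Num.sqrt eps * dot u (jfield p).
Definition cmp3 p u : R := Num.sqrt eps * dot u (jfield (hopf_field p)).

Definition comb p (x1 x2 x3 : R) : R4 := x1 *: frame1 p + x2 *: frame2 p + x3 *: frame3 p.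

Lemma comb_cmp p u : sphere3 p -> tangent p u ->
  u = comb p (cmp1 p u) (cmp2 p u) (cmp3 p u).
Proof.
rewrite /sphere3/= /tangent/= /comb /frame1 /frame2 /frame3 /cmp1 /cmp2 /cmp3.
have r0 : Num.sqrt eps != 0 by rewrite gt_eqF// sqrtr_gt0.
rewrite !scalerA ![_ * _ / _]mulrAC !mulfV ?eps_neq0// !mul1r !dotE => p1 pu.
by apply: coP => -[|[|[|[|//]]]] i4; rewrite !coE/=;
  [ apply: (lincomb2 (m := - co u 0) (n := co p 0) p1 pu)
  | apply: (lincomb2 (m := - co u 1) (n := co p 1) p1 pu)
  | apply: (lincomb2 (m := - co u 2) (n := co p 2) p1 pu)
  | apply: (lincomb2 (m := - co u 3) (n := co p 3) p1 pu)]; ring.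
Qed.

Lemma cmp_comb p x1 x2 x3 : sphere3 p ->
  [/\ cmp1 p (comb p x1 x2 x3) = x1, cmp2 p (comb p x1 x2 x3) = x2
   & cmp3 p (comb p x1 x2 x3) = x3].
Proof.
rewrite /sphere3/= /comb /frame1 /frame2 /frame3 /cmp1 /cmp2 /cmp3 !dotE => p1.
have r0 : Num.sqrt eps != 0 by rewrite gt_eqF// sqrtr_gt0.
have e0 := eps_neq0.
rewrite !coE; split.
- by apply: (lincomb1 (m := x1) p1); field; rewrite e0 r0.
- by apply: (lincomb1 (m := x2) p1); field; rewrite e0 r0.
- by apply: (lincomb1 (m := x3) p1); field; rewrite e0 r0.
Qed.

Lemma comb_tangent p x1 x2 x3 : tangent p (comb p x1 x2 x3).
Proof.
rewrite /tangent/= /comb /frame1 /frame2 /frame3 !dotE !coE; ring.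
Qed.

Lemma berger_dot p u v : sphere3 p -> berger_metric eps p u v =
  eps * (dot u v - dot u (hopf_field p) * dot v (hopf_field p)) +
  eps ^+ 2 * (dot u (hopf_field p) * dot v (hopf_field p)).
Proof.
rewrite /sphere3/= /berger_metric /horiz /vert.
set a := dot u (hopf_field p); set b := dot v (hopf_field p) => p1.
have hh : dot (hopf_field p) (hopf_field p) = 1.
  by rewrite -p1 !dotE !coE; ring.
have E : dot (u - a *: hopf_field p) (v - b *: hopf_field p) = dot u v - a * b.
  apply: (lincomb1 (m := a * b) hh); rewrite /a /b !dotE !(coN, coE); ring.
by rewrite E dotZ hh mulr1.
Qed.

Lemma metric_comb p x1 x2 x3 y1 y2 y3 : sphere3 p ->
  berger_metric eps p (comb p x1 x2 x3) (comb p y1 y2 y3) = x1 * y1 + x2 * y2 + x3 * y3.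
Proof.
move=> p1; rewrite berger_dot// (parseval _ p1 (comb_tangent _ _ _ _)).
have [] := cmp_comb x1 x2 x3 p1; have [] := cmp_comb y1 y2 y3 p1.
rewrite /cmp1 /cmp2 /cmp3; move: (comb p x1 x2 x3) (comb p y1 y2 y3) => u v.
have r2 : Num.sqrt eps ^+ 2 = eps by rewrite sqr_sqrtr// ltW.
by move=> <- <- <- <- <- <-; ring: r2.
Qed.

End Berger.

(** * Vector fields, brackets and the Lie derivative of the metric *)

Section Vector.
Variables (R : realType) (E : normedModType R).
Local Notation R4 := 'rV[R]_4.

Lemma differentiable_coordP (f : E -> R4) x :
  differentiable f x <-> forall i, differentiable (fun y => f y ord0 i : R^o) x.
Proof.
split=> [df i|df].
  have dc := @differentiable_coord R _ _ (f x) ord0 i.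
  exact: (differentiable_comp df dc).
have -> : f = \sum_i (fun y => (f y ord0 i : R) *: ('e_i : R4)).
  by apply/funext => y; rewrite fct_sumE -row_sum_delta.
by apply: differentiable_sum => i; apply: differentiableZl.
Qed.

Lemma derive_coordE (f : E -> R4) x v i : differentiable f x ->
  'D_v f x ord0 i = 'D_v (fun y => f y ord0 i : R^o) x.
Proof. by move=> df; rewrite derive_mx ?mxE//; exact: diff_derivable. Qed.

Lemma smooth_coordP O (f : E -> R4) : open O ->
  smooth_on O f <-> forall i, smooth_on O (fun x => f x ord0 i : R^o).
Proof.
move=> Oo; split=> [fs i|fs].
  have E1 s x : O x -> iterD s (fun y => f y ord0 i : R^o) x = iterD s f x ord0 i.
    elim: s x => //= v s IH x Ox; rewrite derive_coordE; last exact: fs.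
    exact: derive_eq_on Oo Ox IH.
  move=> s x Ox; have /differentiable_coordP/(_ i) := fs s x Ox.
  by apply: differentiable_eq_on Oo Ox _ => y Oy; rewrite E1.
suff H s : (forall x, O x -> differentiable (iterD s f) x) /\
    (forall i x, O x -> iterD s f x ord0 i = iterD s (fun y => f y ord0 i : R^o) x).
  by move=> s x Ox; have [+ _] := H s; apply.
elim: s => [|v s [IHd IH]] /=.
  by split=> // x Ox; apply/differentiable_coordP => i; exact: (fs i [::]).
have E1 i x : O x -> 'D_v (iterD s f) x ord0 i =
    'D_v (iterD s (fun y => f y ord0 i : R^o)) x.
  move=> Ox; rewrite derive_coordE; last exact: IHd.
  exact: derive_eq_on Oo Ox (IH i).
split=> // x Ox; apply/differentiable_coordP => i.
have := fs i (v :: s) x Ox.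
by apply: differentiable_eq_on Oo Ox _ => y Oy; rewrite E1.
Qed.

End Vector.

Section Fields.
Variables (R : realType) (eps : R).
Local Notation R4 := 'rV[R]_4.
Implicit Types (p u v : R4) (V U : set R4) (f : R4 -> R^o) (K H : {linear R4 -> R4}).
Hypothesis eps_gt0 : 0 < eps.
Let d := eps^-1 - 1.
Local Notation E1 := (frame1 eps).
Local Notation E2 := (frame2 eps).
Local Notation E3 := (frame3 eps).
Local Notation e1 := (lie (frame1 eps)).
Local Notation e2 := (lie (frame2 eps)).
Local Notation e3 := (lie (frame3 eps)).
Local Notation smS := (smooth_sheaf_sphere R).

Lemma sphere_smooth_coordP V (X : R4 -> R4) : sphere_open V ->
  sphere_smooth V X <-> forall i, sm V (fun p => X p ord0 i).
Proof.
move=> Vo; rewrite /sphere_smooth smooth_coordP; last exact: cone_open.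
by split=> H i; [apply/smP => //; exact: H|have /smP := H i; exact].
Qed.

Lemma linear_radial K x i : K (radial x) ord0 i = (Num.sqrt (dot x x))^-1 * K x ord0 i.
Proof. by rewrite /radial linearZ mxE. Qed.

Lemma sm_linear V K i : sphere_open V -> sm V (fun p => K p ord0 i).
Proof.
move=> Vo; apply/sm_alg => //.
have H1 : smooth_alg (cone V) (fun x : R4 => (Num.sqrt (dot x x))^-1 : R^o).
  by apply: smooth_alg_norm => x [].
apply: SmoothAlgExt (SmoothAlgM H1 (smooth_alg_linear K _ i)) => x _ /=.
by rewrite linear_radial.
Qed.

Lemma derive_norm p v : sphere3 p -> tangent p v ->
  'D_v (fun x : R4 => (Num.sqrt (dot x x))^-1 : R^o) p = 0.
Proof.
move=> p1 pv; set N : R4 -> R^o := fun x => _.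
have p0 := sphere_neq0 p1.
have Op : [set x : R4 | x != 0] p by [].
have O0 := @open_neq0 R.
have [dN _] := smooth_alg_derive O0 (@smooth_alg_norm R [set x | x != 0] (fun _ => id)).
have [dd _] := smooth_alg_derive O0 (smooth_alg_dot [set x : R4 | x != 0]).
have dN' := diff_derivable (v := v) (dN p Op).
have dd' := diff_derivable (v := v) (dd p Op).
have Np : N p = 1 by rewrite /N p1 sqrtr1 invr1.
have Dd : 'D_v (fun x : R4 => dot x x : R^o) p = 0.
  pose c i : R4 -> R^o := fun x => x ord0 i.
  have dc i : derivable (c i) p v by apply: diff_derivable; exact: differentiable_coord.
  have -> : (fun x : R4 => dot x x : R^o) = \sum_i (c i * c i).
    by apply/funext => x; rewrite fct_sumE.
  rewrite derive_sum => [|i]; last exact: derivableM.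
  rewrite (eq_bigr (fun i => 2 * (p ord0 i * v ord0 i))).
    by rewrite -mulr_sumr -/(dot p v) pv mulr0.
  move=> i _; rewrite deriveM//.
  have -> : 'D_v (c i) p = v ord0 i by exact: derive_coord.
  by rewrite -mulr2n mulr_natl.
have : 'D_v (N * N * (fun x : R4 => dot x x : R^o)) p = 'D_v (cst 1 : R4 -> R^o) p.
  apply: derive_eq_on O0 Op _ => x x0 /=; rewrite /N.
  by rewrite !fctE -invfM -expr2 sqr_sqrtr ?dot_ge0// mulVf// gt_eqF// dot_gt0.
rewrite derive_cst deriveM ?deriveM//; last exact: derivableM.
rewrite Dd scaler0 add0r /= p1 scale1r Np !scale1r -mulr2n => /eqP.
by rewrite mulrn_eq0 => /eqP.
Qed.

(** The extension of the restriction of K is K divided by the norm, and the norm has zero derivative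
    in tangent directions. *)
Lemma lie_linear H K p i : sphere3 p -> tangent p (H p) ->
  lie H (fun q => K q ord0 i) p = K (H p) ord0 i.
Proof.
move=> p1 pv; rewrite /lie; have Op : [set x : R4 | x != 0] p by exact: sphere_neq0.
have O0 := @open_neq0 R.
pose N : R4 -> R^o := fun x => (Num.sqrt (dot x x))^-1.
pose k : R4 -> R^o := fun x => K x ord0 i.
have [dN _] := smooth_alg_derive O0 (@smooth_alg_norm R [set x | x != 0] (fun _ => id)).
have [dk _] := smooth_alg_derive O0 (smooth_alg_linear K [set x : R4 | x != 0] i).
have dN' := diff_derivable (v := H p) (dN p Op).
have dk' := diff_derivable (v := H p) (dk p Op).
have -> : (fun q => K q ord0 i : R^o) \o @radial R = N * k.
  by apply/funext => x; rewrite /= linear_radial.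
rewrite (@deriveM _ _ N k)//.
have -> : 'D_(H p) N p = 0 by exact: derive_norm.
have -> : 'D_(H p) k p = K (H p) ord0 i by exact: derive_linear.
by rewrite scaler0 addr0 /N p1 sqrtr1 invr1 scale1r.
Qed.

End Fields.

Section Brackets.
Variables (R : realType) (eps : R).
Local Notation R4 := 'rV[R]_4.
Implicit Types (p u v : R4) (V U : set R4) (f : R4 -> R^o).
Hypothesis eps_gt0 : 0 < eps.
Let d := eps^-1 - 1.
Local Notation E1 := (frame1 eps).
Local Notation E2 := (frame2 eps).
Local Notation E3 := (frame3 eps).
Local Notation e1 := (lie (frame1 eps)).
Local Notation e2 := (lie (frame2 eps)).
Local Notation e3 := (lie (frame3 eps)).

Let shS := smooth_sheaf_sphere R.
Let smD := smD shS.
Let smM := smM shS.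
Let smC := smC shS.

Definition field_of (x1 x2 x3 : R4 -> R) p : R4 := comb eps p (x1 p) (x2 p) (x3 p).

Lemma combE p x1 x2 x3 (i : 'I_4) :
  comb eps p x1 x2 x3 ord0 i = x1 * E1 p ord0 i + x2 * E2 p ord0 i + x3 * E3 p ord0 i.
Proof. by rewrite !mxE. Qed.

Lemma field_of_vector V x1 x2 x3 : sphere_open V ->
  sm V x1 -> sm V x2 -> sm V x3 -> vector_field V (field_of x1 x2 x3).
Proof.
move=> Vo s1 s2 s3; split; last by move=> p _; exact: comb_tangent.
apply/sphere_smooth_coordP => // i.
apply: (sm_ext shS (f := fun p => x1 p * E1 p ord0 i + x2 p * E2 p ord0 i + x3 p * E3 p ord0 i)).
  by move=> p _; rewrite combE.
by apply: smD; [apply: smD|]; apply: smM => //; exact: sm_linear.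
Qed.

Lemma sm_sum_coord V (X : R4 -> R4) (K : {linear R4 -> R4}) a : sphere_open V ->
  sphere_smooth V X -> sm V (fun p => a * dot (X p) (K p)).
Proof.
move=> Vo /sphere_smooth_coordP => /(_ Vo) sX; apply: smM; first exact: smC.
apply/(sm_alg _ Vo); rewrite /dot.
apply: (@smooth_alg_sum _ _ _ _ (fun i x => X (radial x) ord0 i * K (radial x) ord0 i)) => i.
apply: SmoothAlgM.
  by have /(sm_alg _ Vo) := sX i.
by have /(sm_alg _ Vo) := sm_linear K i Vo.
Qed.

Lemma vector_fieldP V X : sphere_open V -> vector_field V X ->
  exists x1 x2 x3 : R4 -> R, [/\ sm V x1, sm V x2, sm V x3 &
    forall p, V p -> X p = field_of x1 x2 x3 p].
Proof.
move=> Vo [sX tX]; exists (fun p => cmp1 eps p (X p)), (fun p => cmp2 eps p (X p)),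
  (fun p => cmp3 eps p (X p)); split.
- exact: (sm_sum_coord _ _ Vo sX).
- exact: (sm_sum_coord _ _ Vo sX).
- exact: (@sm_sum_coord _ _ (@jfield R \o @hopf_field R) _ Vo sX).
- move=> p Vp; rewrite /field_of -comb_cmp//; [exact: sphere_openP Vp|exact: tX].
Qed.

Lemma sphere_D_comb V f p x1 x2 x3 : sphere_open V -> sm V f -> V p ->
  sphere_D f p (comb eps p x1 x2 x3) = x1 * e1 f p + x2 * e2 f p + x3 * e3 f p.
Proof.
move=> Vo fs Vp; have df := sm_diff Vo fs (cone_sphere Vo Vp).
by rewrite /sphere_D /lie !deriveE// /comb !linearD !linearZ.
Qed.

Lemma sphere_D_ext (F : normedModType R) V (f g : R4 -> F) p v : sphere_open V -> V p ->
  (forall q, V q -> f q = g q) -> sphere_D f p v = sphere_D g p v.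
Proof.
move=> Vo Vp fg; apply: derive_eq_on (cone_open Vo) (cone_sphere Vo Vp) _.
by move=> y [_ /fg].
Qed.

Lemma bracket_ext V X X' Y Y' p : sphere_open V -> V p ->
  (forall q, V q -> X q = X' q) -> (forall q, V q -> Y q = Y' q) ->
  bracket X Y p = bracket X' Y' p.
Proof.
move=> Vo Vp XX' YY'; rewrite /bracket (sphere_D_ext _ Vo Vp XX').
by rewrite (sphere_D_ext _ Vo Vp YY') XX' ?YY'.
Qed.

Lemma bracketC X Y p : bracket X Y p = - bracket Y X p :> R4.
Proof. by rewrite /bracket opprB. Qed.

Lemma lie_field_coord V (K : {linear R4 -> R4}) y1 y2 y3 p i : sphere_open V ->
  sm V y1 -> sm V y2 -> sm V y3 -> V p -> tangent p (K p) ->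
  lie K (fun q => field_of y1 y2 y3 q ord0 i) p =
    lie K y1 p * E1 p ord0 i + lie K y2 p * E2 p ord0 i + lie K y3 p * E3 p ord0 i +
    (y1 p * E1 (K p) ord0 i + y2 p * E2 (K p) ord0 i + y3 p * E3 (K p) ord0 i).
Proof.
move=> Vo s1 s2 s3 Vp tK; have dK := lie_derivation K Vo.
have p1 := sphere_openP Vo Vp.
have sE (L : {linear R4 -> R4}) : sm V (fun q => L q ord0 i) by exact: sm_linear.
rewrite (der_ext dK (g := fun q =>
  y1 q * E1 q ord0 i + y2 q * E2 q ord0 i + y3 q * E3 q ord0 i))//; last first.
  by move=> q _; rewrite /field_of combE.
rewrite (derD dK) ?(derD dK) ?(derM dK)//; do ?[by apply: smM|by apply: smD; apply: smM].
rewrite !lie_linear//; ring.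
Qed.

Lemma tangent_frame p : [/\ tangent p (E1 p), tangent p (E2 p) & tangent p (E3 p)].
Proof.
by split; rewrite /tangent/= /frame1 /frame2 /frame3 dotE !coE; ring.
Qed.

Lemma coordB u v i : (u - v) ord0 i = u ord0 i - v ord0 i.
Proof. by rewrite !mxE. Qed.

Lemma coordZ a u i : (a *: u) ord0 i = a * u ord0 i.
Proof. by rewrite mxE. Qed.

Lemma bracket_field V (x1 x2 x3 y1 y2 y3 : R4 -> R) p : sphere_open V ->
  sm V x1 -> sm V x2 -> sm V x3 -> sm V y1 -> sm V y2 -> sm V y3 -> V p ->
  bracket (field_of x1 x2 x3) (field_of y1 y2 y3) p = comb eps p
   (x1 p * e1 y1 p + x2 p * e2 y1 p + x3 p * e3 y1 p
    - (y1 p * e1 x1 p + y2 p * e2 x1 p + y3 p * e3 x1 p)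
    + 2 * (x2 p * y3 p - x3 p * y2 p))
   (x1 p * e1 y2 p + x2 p * e2 y2 p + x3 p * e3 y2 p
    - (y1 p * e1 x2 p + y2 p * e2 x2 p + y3 p * e3 x2 p)
    - (2 + 2 * d) * (x1 p * y3 p - x3 p * y1 p))
   (x1 p * e1 y3 p + x2 p * e2 y3 p + x3 p * e3 y3 p
    - (y1 p * e1 x3 p + y2 p * e2 x3 p + y3 p * e3 x3 p)
    + (2 + 2 * d) * (x1 p * y2 p - x2 p * y1 p)).
Proof.
move=> Vo sx1 sx2 sx3 sy1 sy2 sy3 Vp; apply/rowP => i.
have Cp := cone_sphere Vo Vp.
have sX := field_of_vector Vo sx1 sx2 sx3; have sY := field_of_vector Vo sy1 sy2 sy3.
have coordD (Z : R4 -> R4) v : vector_field V Z ->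
    sphere_D Z p v ord0 i = sphere_D (fun q => Z q ord0 i : R^o) p v.
  move=> [sZ _]; rewrite /sphere_D derive_coordE//.
  exact: (sZ [::] p Cp).
have smco (Z : R4 -> R4) : vector_field V Z -> sm V (fun q => Z q ord0 i).
  by move=> [/(sphere_smooth_coordP _ Vo)].
rewrite coordB !coordD//.
rewrite {2 4}/field_of !(sphere_D_comb _ _ _ Vo (smco _ _) Vp)//.
have [t1 t2 t3] := tangent_frame p.
rewrite (lie_field_coord i Vo sy1 sy2 sy3 Vp t1) (lie_field_coord i Vo sy1 sy2 sy3 Vp t2).
rewrite (lie_field_coord i Vo sy1 sy2 sy3 Vp t3) (lie_field_coord i Vo sx1 sx2 sx3 Vp t1).
rewrite (lie_field_coord i Vo sx1 sx2 sx3 Vp t2) (lie_field_coord i Vo sx1 sx2 sx3 Vp t3).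
rewrite [RHS]combE.
have F12 : E2 (E1 p) ord0 i - E1 (E2 p) ord0 i = (2 + 2 * d) * E3 p ord0 i.
  by rewrite -coordB frame12; exact: coordZ.
have F13 : E3 (E1 p) ord0 i - E1 (E3 p) ord0 i = - (2 + 2 * d) * E2 p ord0 i.
  by rewrite -coordB frame13; exact: coordZ.
have F23 : E3 (E2 p) ord0 i - E2 (E3 p) ord0 i = 2 * E1 p ord0 i.
  by rewrite -coordB frame23//; exact: coordZ.
rewrite /reverse_coercion /=.
apply: (lincomb3 (m := x1 p * y2 p - y1 p * x2 p) (n := x1 p * y3 p - y1 p * x3 p)
  (k := x2 p * y3 p - y2 p * x3 p) F12 F13 F23).
generalize (E1 p ord0 i) (E2 p ord0 i) (E3 p ord0 i) (E2 (E1 p) ord0 i) (E1 (E2 p) ord0 i)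
  (E3 (E1 p) ord0 i) (E1 (E3 p) ord0 i) (E3 (E2 p) ord0 i) (E2 (E3 p) ord0 i)
  (E1 (E1 p) ord0 i) (E2 (E2 p) ord0 i) (E3 (E3 p) ord0 i).
(* Without generalization [ring] compares derivatives up to conversion. *)
repeat match goal with |- context [lie ?K ?f p] => generalize (lie K f p) end.
generalize (x1 p) (x2 p) (x3 p) (y1 p) (y2 p) (y3 p).
move=> *; ring.
Qed.

End Brackets.

Section Metric.
Variables (R : realType) (eps : R).
Local Notation R4 := 'rV[R]_4.
Implicit Types (p u v : R4) (V U W : set R4) (f : R4 -> R).
Hypothesis eps_gt0 : 0 < eps.
Let d := eps^-1 - 1.
Local Notation e1 := (lie (frame1 eps)).
Local Notation e2 := (lie (frame2 eps)).
Local Notation e3 := (lie (frame3 eps)).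
Let shS := smooth_sheaf_sphere R.
Let smD := smD shS.
Let smM := smM shS.
Let smC := smC shS.

Lemma dotDl u u' v : dot (u + u') v = dot u v + dot u' v :> R.
Proof. by rewrite !dotE !coD; ring. Qed.

Lemma dotC u v : dot u v = dot v u :> R.
Proof. by rewrite !dotE; ring. Qed.

Lemma berger_metricC p u v : berger_metric eps p u v = berger_metric eps p v u.
Proof. by rewrite /berger_metric dotC [dot (vert p u) _]dotC. Qed.

Lemma berger_metricDl p u u' v :
  berger_metric eps p (u + u') v = berger_metric eps p u v + berger_metric eps p u' v.
Proof.
have vD : vert p (u + u') = vert p u + vert p u' by rewrite /vert dotDl scalerDl.
have hD : horiz p (u + u') = horiz p u + horiz p u'.
  by rewrite /horiz vD opprD addrACA.
by rewrite /berger_metric hD vD !dotDl; ring.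
Qed.

Lemma berger_metricNl p u v : berger_metric eps p (- u) v = - berger_metric eps p u v.
Proof.
have vN : vert p (- u) = - vert p u.
  by rewrite /vert -scaleNr; congr (_ *: _); rewrite !dotE !coN; ring.
have hN : horiz p (- u) = - horiz p u by rewrite /horiz vN opprD.
by rewrite /berger_metric hN vN !dotE !coN; ring.
Qed.

(* [deform_ij] is the component on [e_i], [e_j] of the Lie derivative of the metric
   along [sum t_i e_i]. *)
Definition deform11 (t1 t2 t3 : R4 -> R) p : R := 2 * e1 t1 p.
Definition deform22 (t1 t2 t3 : R4 -> R) p : R := 2 * e2 t2 p.
Definition deform33 (t1 t2 t3 : R4 -> R) p : R := 2 * e3 t3 p.
Definition deform12 (t1 t2 t3 : R4 -> R) p : R := e1 t2 p + e2 t1 p - 2 * d * t3 p.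
Definition deform13 (t1 t2 t3 : R4 -> R) p : R := e1 t3 p + e3 t1 p + 2 * d * t2 p.
Definition deform23 (t1 t2 t3 : R4 -> R) p : R := e2 t3 p + e3 t2 p.

(** The left side is the Lie derivative of the metric along T, evaluated on X and Y. It is
    tensorial: the derivatives of the components of X and Y cancel. *)
Lemma lie_metric V (x1 x2 x3 y1 y2 y3 t1 t2 t3 : R4 -> R) p : sphere_open V -> V p ->
  sm V x1 -> sm V x2 -> sm V x3 -> sm V y1 -> sm V y2 -> sm V y3 ->
  sm V t1 -> sm V t2 -> sm V t3 ->
  let X := field_of eps x1 x2 x3 in let Y := field_of eps y1 y2 y3 in
  let T := field_of eps t1 t2 t3 in
  sphere_D ((fun q => berger_metric eps q (X q) (Y q)) : R4 -> R^o) p (T p)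
  + berger_metric eps p (bracket X T p) (Y p)
  + berger_metric eps p (X p) (bracket Y T p) =
  x1 p * y1 p * deform11 t1 t2 t3 p + x2 p * y2 p * deform22 t1 t2 t3 p
  + x3 p * y3 p * deform33 t1 t2 t3 p
  + (x1 p * y2 p + x2 p * y1 p) * deform12 t1 t2 t3 p
  + (x1 p * y3 p + x3 p * y1 p) * deform13 t1 t2 t3 p
  + (x2 p * y3 p + x3 p * y2 p) * deform23 t1 t2 t3 p.
Proof.
move=> Vo Vp sx1 sx2 sx3 sy1 sy2 sy3 st1 st2 st3 X Y T.
have p1 := sphere_openP Vo Vp.
have sXY : sm V (fun q => x1 q * y1 q + x2 q * y2 q + x3 q * y3 q).
  by apply: smD; [apply: smD|]; apply: smM.
rewrite (sphere_D_ext (V := V) (g := (fun q =>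
  x1 q * y1 q + x2 q * y2 q + x3 q * y3 q : R^o)))//; last first.
  by move=> q Vq; apply: metric_comb => //; exact: sphere_openP Vq.
rewrite (sphere_D_comb eps _ _ _ Vo sXY Vp).
rewrite (bracket_field eps_gt0 Vo)// (bracket_field eps_gt0 Vo)// !metric_comb//.
have dl (K : {linear R4 -> R4}) : lie K (fun q => x1 q * y1 q + x2 q * y2 q + x3 q * y3 q) p =
   lie K x1 p * y1 p + x1 p * lie K y1 p + (lie K x2 p * y2 p + x2 p * lie K y2 p)
   + (lie K x3 p * y3 p + x3 p * lie K y3 p).
  have dK := lie_derivation K Vo.
  by rewrite (derD dK) ?(derD dK) ?(derM dK)//; do ?[by apply: smM|by apply: smD; apply: smM].
rewrite !dl /deform11 /deform22 /deform33 /deform12 /deform13 /deform23 -/d /reverse_coercion.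
clear dl.
repeat match goal with |- context [lie ?K ?f p] => generalize (lie K f p) end.
generalize (x1 p) (x2 p) (x3 p) (y1 p) (y2 p) (y3 p) (t1 p) (t2 p) (t3 p).
move=> *; ring.
Qed.

End Metric.

(** * From metric foliations to Killing fields *)

Section Foliation.
Variables (R : realType) (eps : R).
Local Notation R4 := 'rV[R]_4.
Implicit Types (p u v : R4) (V U W : set R4) (f : R4 -> R).
Hypothesis eps_gt0 : 0 < eps.
Let d := eps^-1 - 1.
Local Notation e1 := (lie (frame1 eps)).
Local Notation e2 := (lie (frame2 eps)).
Local Notation e3 := (lie (frame3 eps)).
Let shS := smooth_sheaf_sphere R.
Let smD := smD shS.
Let smM := smM shS.
Let smC := smC shS.
Let smN := @smN _ _ _ shS.

(** By compatibility with the metric and absence of torsion the left side is g(nabla_X T, Y) + g(X,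
    nabla_Y T), which by orthogonality equals - g(T, nabla_X Y + nabla_Y X). *)
Lemma metric_foliation_lie nabla TF U T X Y p :
  levi_civita eps nabla -> metric_foliation eps nabla TF ->
  sphere_open U -> vector_field U T -> (forall q, U q -> TF q (T q)) ->
  orthogonal_section eps TF U X -> orthogonal_section eps TF U Y -> U p ->
  sphere_D ((fun q => berger_metric eps q (X q) (Y q)) : R4 -> R^o) p (T p)
  + berger_metric eps p (bracket X T p) (Y p)
  + berger_metric eps p (X p) (bracket Y T p) = 0.
Proof.
move=> lc mf Uo vT TT oX oY Up; have [vX gX] := oX; have [vY gY] := oY.
have [_ /(_ p Up _ (TT p Up))] := mf U X Y Uo oX oY.
rewrite berger_metricDl => A.
have zero (Z Z' : R4 -> R4) : (forall q, U q -> berger_metric eps q (Z q) (T q) = 0) ->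
    sphere_D ((fun q => berger_metric eps q (Z q) (T q)) : R4 -> R^o) p (Z' p) = 0.
  move=> Z0; rewrite (sphere_D_ext (V := U) (g := fun=> 0 : R^o))//.
  exact: derive_cst.
have B := lc_metric lc Uo vX vY vT Up.
rewrite zero in B; last by move=> q Uq; apply: gY => //; exact: TT.
have C := lc_metric lc Uo vY vX vT Up.
rewrite zero in C; last by move=> q Uq; apply: gX => //; exact: TT.
rewrite (lc_metric lc Uo vT vX vY Up) -(lc_torsion_free lc Uo vX vT Up).
rewrite -(lc_torsion_free lc Uo vY vT Up) berger_metricDl berger_metricNl.
rewrite [berger_metric eps p (X p) (_ - _)]berger_metricC berger_metricDl berger_metricNl.
rewrite [berger_metric eps p (nabla T Y p) _]berger_metricC.
rewrite [berger_metric eps p (nabla Y T p) _]berger_metricC.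
rewrite [berger_metric eps p (nabla X T p) _]berger_metricC.
lra.
Qed.

Section UnitFlow.
Variables (nabla : (R4 -> R4) -> (R4 -> R4) -> R4 -> R4) (TF : R4 -> set R4) (U : set R4).
Variables (t1 t2 t3 : R4 -> R).
Hypotheses (lc : levi_civita eps nabla) (mf : metric_foliation eps nabla TF).
Hypotheses (Uo : sphere_open U) (st1 : sm U t1) (st2 : sm U t2) (st3 : sm U t3).
Hypothesis norm_t : forall q, U q -> t1 q ^+ 2 + t2 q ^+ 2 + t3 q ^+ 2 = 1.
Hypothesis TFT : forall q, U q ->
  TF q = [set b *: field_of eps t1 t2 t3 q | b in [set: R]].

(** The Lie derivative of the metric evaluated on T and e_i; as T has unit length this is <nabla_T
    T, e_i>. *)
Definition curv1 q := t1 q * deform11 eps t1 t2 t3 q + t2 q * deform12 eps t1 t2 t3 q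
  + t3 q * deform13 eps t1 t2 t3 q.
Definition curv2 q := t1 q * deform12 eps t1 t2 t3 q + t2 q * deform22 eps t1 t2 t3 q
  + t3 q * deform23 eps t1 t2 t3 q.
Definition curv3 q := t1 q * deform13 eps t1 t2 t3 q + t2 q * deform23 eps t1 t2 t3 q
  + t3 q * deform33 eps t1 t2 t3 q.
Definition twist q := - 2^-1 * (t1 q * (e2 t3 q - e3 t2 q - 2 * t1 q)
  + t2 q * (e3 t1 q - e1 t3 q - (2 + 2 * d) * t2 q)
  + t3 q * (e1 t2 q - e2 t1 q - (2 + 2 * d) * t3 q)).

(** Projecting the constant combinations of the frame gives sections that span the orthogonal
    distribution without choosing a frame of it. *)
Lemma projection_orthogonal (c1 c2 c3 : R) (j : R4 -> R) : sm U j ->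
  (forall q, U q -> j q = c1 * t1 q + c2 * t2 q + c3 * t3 q) ->
  orthogonal_section eps TF U (field_of eps (fun q => c1 - j q * t1 q)
    (fun q => c2 - j q * t2 q) (fun q => c3 - j q * t3 q)).
Proof.
move=> sj jE; split.
  by apply: field_of_vector => //; (apply: smD; [exact: smC|apply: smN; exact: smM]).
move=> q Uq w; rewrite TFT// => -[b _ <-].
have q1 := sphere_openP Uo Uq.
have -> : b *: field_of eps t1 t2 t3 q = comb eps q (b * t1 q) (b * t2 q) (b * t3 q).
  by rewrite /field_of /comb !scalerDr !scalerA.
rewrite metric_comb//.
by apply: (lincomb2 (m := - b * j q) (n := - b) (norm_t Uq) (jE q Uq)); ring.
Qed.

Lemma unit_row (K : {linear R4 -> R4}) q : U q ->
  t1 q * lie K t1 q + t2 q * lie K t2 q + t3 q * lie K t3 q = 0.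
Proof.
move=> Uq; have dK := lie_derivation K Uo.
have q1 := is_derE (lie K) st1; have q2 := is_derE (lie K) st2; have q3 := is_derE (lie K) st3.
have shS' := shS.
have := is_der_congr dK norm_t ltac:(der) ltac:(der) Uq.
move=> /= E; apply: (lincomb1 (m := 2^-1) E).
generalize (lie K t1 q) (lie K t2 q) (lie K t3 q) (t1 q) (t2 q) (t3 q) => *; by field.
Qed.

Lemma unit_flow : riemannian_flow (@sm R) d e1 e2 e3 U t1 t2 t3 curv1 curv2 curv3 twist.
Proof.
have vT : vector_field U (field_of eps t1 t2 t3) by exact: field_of_vector.
have TT q : U q -> TF q (field_of eps t1 t2 t3 q).
  by move=> Uq; rewrite TFT//; exists 1 => //; rewrite scale1r.
have o1 := projection_orthogonal (c1 := 1) (c2 := 0) (c3 := 0) st1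
  (fun q _ => ltac:(by rewrite mul1r !mul0r !addr0)).
have o2 := projection_orthogonal (c1 := 0) (c2 := 1) (c3 := 0) st2
  (fun q _ => ltac:(by rewrite mul1r !mul0r add0r addr0)).
have o3 := projection_orthogonal (c1 := 0) (c2 := 0) (c3 := 1) st3
  (fun q _ => ltac:(by rewrite mul1r !mul0r !add0r)).
have sz c (x y : R4 -> R) : sm U x -> sm U y -> sm U (fun q => c - x q * y q).
  by move=> sx sy; apply: smD; [exact: smC|apply: smN; exact: smM].
have se (K : {linear R4 -> R4}) x : sm U x -> sm U (lie K x : R4 -> R) by exact: lie_sm.
have s3 (x1 x2 x3 y1 y2 y3 : R4 -> R) : sm U x1 -> sm U x2 -> sm U x3 -> sm U y1 ->
    sm U y2 -> sm U y3 -> sm U (fun q => x1 q * y1 q + x2 q * y2 q + x3 q * y3 q).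
  by move=> *; apply: smD; [apply: smD|]; exact: smM.
have sS11 : sm U (deform11 eps t1 t2 t3) by apply: smM; [exact: smC|exact: se].
have sS22 : sm U (deform22 eps t1 t2 t3) by apply: smM; [exact: smC|exact: se].
have sS33 : sm U (deform33 eps t1 t2 t3) by apply: smM; [exact: smC|exact: se].
have sS12 : sm U (deform12 eps t1 t2 t3).
  apply: smD; last by apply: smN; apply: smM => //; exact: smC.
  by apply: smD; exact: se.
have sS13 : sm U (deform13 eps t1 t2 t3).
  apply: smD; last by apply: smM => //; exact: smC.
  by apply: smD; exact: se.
have sS23 : sm U (deform23 eps t1 t2 t3) by apply: smD; exact: se.
have quad (x1 x2 x3 y1 y2 y3 : R4 -> R) q : sm U x1 -> sm U x2 -> sm U x3 ->
    sm U y1 -> sm U y2 -> sm U y3 ->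
    orthogonal_section eps TF U (field_of eps x1 x2 x3) ->
    orthogonal_section eps TF U (field_of eps y1 y2 y3) -> U q ->
    x1 q * y1 q * deform11 eps t1 t2 t3 q + x2 q * y2 q * deform22 eps t1 t2 t3 q
    + x3 q * y3 q * deform33 eps t1 t2 t3 q
    + (x1 q * y2 q + x2 q * y1 q) * deform12 eps t1 t2 t3 q
    + (x1 q * y3 q + x3 q * y1 q) * deform13 eps t1 t2 t3 q
    + (x2 q * y3 q + x3 q * y2 q) * deform23 eps t1 t2 t3 q = 0.
  move=> sx1 sx2 sx3 sy1 sy2 sy3 ox oy Uq.
  rewrite -(lie_metric eps_gt0 Uo Uq)//.
  exact: metric_foliation_lie lc mf Uo vT TT ox oy Uq.
have alg q : U q -> [/\ t1 q * curv1 q + t2 q * curv2 q + t3 q * curv3 q = 0,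
   [/\ e1 t1 q = t1 q * curv1 q, e2 t2 q = t2 q * curv2 q & e3 t3 q = t3 q * curv3 q],
   [/\ e1 t2 q = t1 q * curv2 q - twist q * t3 q + (1 + 2 * d) * t3 q,
     e1 t3 q = t1 q * curv3 q + twist q * t2 q - (1 + 2 * d) * t2 q
     & e2 t3 q = t2 q * curv3 q - twist q * t1 q + t1 q] &
   [/\ e2 t1 q = t2 q * curv1 q + twist q * t3 q - t3 q,
     e3 t1 q = t3 q * curv1 q - twist q * t2 q + t2 q
     & e3 t2 q = t3 q * curv2 q + twist q * t1 q - t1 q]].
  move=> Uq; have r1 := unit_row (frame1 eps) Uq.
  have r2 := unit_row (frame2 eps) Uq; have r3 := unit_row (frame3 eps) Uq.
  have s11 := sz 1 _ _ st1 st1; have s12 := sz 0 _ _ st1 st2; have s13 := sz 0 _ _ st1 st3.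
  have s21 := sz 0 _ _ st2 st1; have s22 := sz 1 _ _ st2 st2; have s23 := sz 0 _ _ st2 st3.
  have s31 := sz 0 _ _ st3 st1; have s32 := sz 0 _ _ st3 st2; have s33 := sz 1 _ _ st3 st3.
  have q11 := quad _ _ _ _ _ _ q s11 s12 s13 s11 s12 s13 o1 o1 Uq.
  have q22 := quad _ _ _ _ _ _ q s21 s22 s23 s21 s22 s23 o2 o2 Uq.
  have q33 := quad _ _ _ _ _ _ q s31 s32 s33 s31 s32 s33 o3 o3 Uq.
  have q12 := quad _ _ _ _ _ _ q s11 s12 s13 s21 s22 s23 o1 o2 Uq.
  have q13 := quad _ _ _ _ _ _ q s11 s12 s13 s31 s32 s33 o1 o3 Uq.
  have q23 := quad _ _ _ _ _ _ q s21 s22 s23 s31 s32 s33 o2 o3 Uq.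
  split.
  - exact: (deform_orth d r1 r2 r3).
  - exact: (flow_algebra1 r1 r2 r3 q11 q22 q33 q12 q13 q23).
  - exact: (flow_algebra2 (norm_t Uq) r1 r2 r3 q11 q22 q33 q12 q13 q23).
  - exact: (flow_algebra3 (norm_t Uq) r1 r2 r3 q11 q22 q33 q12 q13 q23).
split.
- by [].
- by split; apply: s3.
- rewrite /twist; apply: smM; first exact: smC.
  apply: s3 => //.
  + apply: smD; last by apply: smN; apply: smM => //; exact: smC.
    by apply: smD; [exact: se|apply: smN; exact: se].
  + apply: smD; last by apply: smN; apply: smM => //; exact: smC.
    by apply: smD; [exact: se|apply: smN; exact: se].
  + apply: smD; last by apply: smN; apply: smM => //; exact: smC.
    by apply: smD; [exact: se|apply: smN; exact: se].
- exact: norm_t.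
- by move=> p /alg[].
- by move=> p /alg[_ []].
- by move=> p /alg[_ _ []].
- by move=> p /alg[_ _ []].
- by move=> p /alg[_ _ _ []].
- by move=> p /alg[_ []].
- by move=> p /alg[_ _ []].
- by move=> p /alg[_ _ _ []].
- by move=> p /alg[_ _ _ []].
- by move=> p /alg[_ []].
Qed.
End UnitFlow.

End Foliation.

(** * Unit flows tangent to the foliation and their Killing multiples *)

Section Killing.
Variables (R : realType) (eps : R).
Local Notation R4 := 'rV[R]_4.
Implicit Types (p u v : R4) (V U W : set R4) (f : R4 -> R).
Hypothesis eps_gt0 : 0 < eps.
Let d := eps^-1 - 1.
Local Notation e1 := (lie (frame1 eps)).
Local Notation e2 := (lie (frame2 eps)).
Local Notation e3 := (lie (frame3 eps)).
Let shS := smooth_sheaf_sphere R.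
Let smD := smD shS.
Let smM := smM shS.
Let smC := smC shS.
Let smN := @smN _ _ _ shS.

Lemma foliation_flow nabla TF p0 :
  levi_civita eps nabla -> foliation1 TF -> metric_foliation eps nabla TF ->
  sphere3 p0 -> exists U t1 t2 t3 k1 k2 k3 a, [/\ sphere_open U, U p0,
    riemannian_flow (@sm R) d e1 e2 e3 U t1 t2 t3 k1 k2 k3 a &
    forall q, U q -> TF q = [set b *: field_of eps t1 t2 t3 q | b in [set: R]]].
Proof.
move=> lc fol mf sp0.
have [U [T0 [Uo Up0 vT0 TFE]]] := foliation1_smooth fol sp0.
have [y1 [y2 [y3 [sy1 sy2 sy3 T0E]]]] := vector_fieldP eps_gt0 Uo vT0.
have n0 q : U q -> 0 < y1 q * y1 q + y2 q * y2 q + y3 q * y3 q.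
  move=> Uq; have [+ _] := TFE q Uq; rewrite lt_def !addr_ge0 ?andbT -?expr2 ?sqr_ge0//.
  apply: contra; rewrite !paddr_eq0 ?addr_ge0 ?sqr_ge0// !sqrf_eq0.
  move=> /andP[/andP[/eqP a1 /eqP a2] /eqP a3].
  by rewrite T0E// /field_of a1 a2 a3 /comb !scale0r !addr0.
pose r q : R := Num.sqrt (y1 q * y1 q + y2 q * y2 q + y3 q * y3 q).
have sr : sm U r by apply: (sm_sqrt shS) => //; apply: smD; [apply: smD|]; apply: smM.
have r0 q : U q -> r q != 0 by move=> /n0 yq; rewrite gt_eqF// sqrtr_gt0.
have r2 q : U q -> r q ^+ 2 = y1 q * y1 q + y2 q * y2 q + y3 q * y3 q.
  by move=> /n0 yq; rewrite sqr_sqrtr// ltW.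
have sri : sm U (fun q => (r q)^-1) by exact: (smV shS).
pose t1 q : R := y1 q * (r q)^-1; pose t2 q : R := y2 q * (r q)^-1.
pose t3 q : R := y3 q * (r q)^-1.
have st1 : sm U t1 by exact: smM.
have st2 : sm U t2 by exact: smM.
have st3 : sm U t3 by exact: smM.
have unit q : U q -> t1 q ^+ 2 + t2 q ^+ 2 + t3 q ^+ 2 = 1.
  by move=> Uq; rewrite !exprMn -!mulrDl exprVn !expr2 -r2// mulfV// expf_neq0// r0.
have TFT q : U q -> TF q = [set b *: field_of eps t1 t2 t3 q | b in [set: R]].
  move=> Uq; have [_ ->] := TFE q Uq.
  have E : T0 q = r q *: field_of eps t1 t2 t3 q.
    rewrite T0E// /field_of /comb !scalerDr !scalerA /t1 /t2 /t3.
    by rewrite ![r q * _]mulrC !divfK ?r0.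
  rewrite E; apply/seteqP; split=> _ [b _ <-]/=.
    by exists (b * r q) => //; rewrite scalerA.
  by exists (b / r q) => //; rewrite scalerA divfK// r0.
have fl := unit_flow eps_gt0 lc mf Uo st1 st2 st3 unit TFT.
by exists U, t1, t2, t3, (curv1 eps t1 t2 t3), (curv2 eps t1 t2 t3),
  (curv3 eps t1 t2 t3), (twist eps t1 t2 t3); split.
Qed.

(** The Lie derivative of the metric along F T is the symmetric product of F k + dF with the dual of
    T, so its six components vanish. *)
Lemma killing_of_flow U W t1 t2 t3 k1 k2 k3 a (F : R4 -> R) :
  riemannian_flow (@sm R) d e1 e2 e3 U t1 t2 t3 k1 k2 k3 a ->
  sphere_open W -> W `<=` U -> sm W F ->
  (forall p, W p -> e1 F p = - F p * k1 p) ->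
  (forall p, W p -> e2 F p = - F p * k2 p) ->
  (forall p, W p -> e3 F p = - F p * k3 p) ->
  killing eps W (fun p => F p *: field_of eps t1 t2 t3 p).
Proof.
move=> fl Wo WU sF F1 F2 F3.
have [[st1 st2 st3] _ _ _ _ f11 f12 f13 f21 f22 f23 f31 f32 f33] := flowS shS WU fl.
pose y1 q : R := F q * t1 q; pose y2 q : R := F q * t2 q; pose y3 q : R := F q * t3 q.
have sy1 : sm W y1 by exact: smM.
have sy2 : sm W y2 by exact: smM.
have sy3 : sm W y3 by exact: smM.
have -> : (fun p => F p *: field_of eps t1 t2 t3 p) = field_of eps y1 y2 y3.
  by apply/funext => p; rewrite /field_of /comb !scalerDr !scalerA.
split; first exact: field_of_vector.
move=> V X Y Vo VW vX vY p Vp.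
have [x1 [x2 [x3 [sx1 sx2 sx3 XE]]]] := vector_fieldP eps_gt0 Vo vX.
have [z1 [z2 [z3 [sz1 sz2 sz3 YE]]]] := vector_fieldP eps_gt0 Vo vY.
have sub f : sm W f -> sm V f by exact: (smS shS).
rewrite [bracket _ X p]bracketC [bracket _ Y p]bracketC.
rewrite (bracket_ext Vo Vp XE (fun _ _ => erefl)) (bracket_ext Vo Vp YE (fun _ _ => erefl)).
rewrite (XE p Vp) (YE p Vp).
rewrite (sphere_D_ext (V := V) (g := (fun q =>
  berger_metric eps q (field_of eps x1 x2 x3 q) (field_of eps z1 z2 z3 q) : R^o)))//; last first.
  by move=> q Vq; rewrite XE// YE.
have := lie_metric eps_gt0 Vo Vp sx1 sx2 sx3 sz1 sz2 sz3 (sub _ sy1) (sub _ sy2) (sub _ sy3).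
rewrite [in X in _ -> X]berger_metricNl [X in _ -> _ = _ + X]berger_metricC.
rewrite [X in _ -> _ = _ + X]berger_metricNl [X in _ -> _ = _ - X]berger_metricC /=.
have Wp := VW _ Vp.
have dM (K : {linear R4 -> R4}) t : sm W t -> lie K (fun q => F q * t q) p =
    lie K F p * t p + F p * lie K t p.
  by move=> st; rewrite (derM (lie_derivation K Wo)).
have -> : deform11 eps y1 y2 y3 p = 0.
  by rewrite /deform11 dM// F1// f11//; ring.
have -> : deform22 eps y1 y2 y3 p = 0.
  by rewrite /deform22 dM// F2// f22//; ring.
have -> : deform33 eps y1 y2 y3 p = 0.
  by rewrite /deform33 dM// F3// f33//; ring.
have -> : deform12 eps y1 y2 y3 p = 0.
  by rewrite /deform12 !dM// F1// F2// f12// f21// /y3 /d; ring.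
have -> : deform13 eps y1 y2 y3 p = 0.
  by rewrite /deform13 !dM// F1// F3// f13// f31// /y2 /d; ring.
have -> : deform23 eps y1 y2 y3 p = 0.
  by rewrite /deform23 !dM// F2// F3// f23// f32//; ring.
rewrite !mulr0 !addr0 => E.
by apply: (lincomb1 (m := 1) E); ring.
Qed.

End Killing.

(** * Logarithmic potentials of the mean curvature form *)

Section Potential.
Variables (R : realType) (eps : R).
Local Notation R4 := 'rV[R]_4.
Implicit Types (p : R4) (V U W : set R4).
Hypothesis eps_gt0 : 0 < eps.
Let d := eps^-1 - 1.
Local Notation e1 := (lie (frame1 eps)).
Local Notation e2 := (lie (frame2 eps)).
Local Notation e3 := (lie (frame3 eps)).
Let shS := smooth_sheaf_sphere R.
Variables (U : set R4) (t1 t2 t3 k1 k2 k3 a : R4 -> R).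
Hypothesis Uo : sphere_open U.
Hypothesis fl : riemannian_flow (@sm R) d e1 e2 e3 U t1 t2 t3 k1 k2 k3 a.
Hypothesis rig : forall p, U p -> rigid d e1 e2 e3 t1 t2 t3 k1 k2 k3 a p.

(* [F] times a vector field with mean curvature form [k] is Killing when [dF = - F k]. *)
Definition log_potential W (F : R4 -> R) : Prop :=
  [/\ sm W F, forall p, W p -> F p != 0,
    forall p, W p -> e1 F p = - F p * k1 p,
    forall p, W p -> e2 F p = - F p * k2 p &
    forall p, W p -> e3 F p = - F p * k3 p].

Let st1 : sm U t1. Proof. by have [[]] := fl. Qed.
Let sa : sm U a. Proof. by have [] := fl. Qed.

Let A p := a p + d * t1 p ^+ 2.
Let B p := 1 + a p + 2 * d * t1 p ^+ 2.

(* The potential is [|A| ^ (-1/2)]. *)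
Lemma generic_potential p : U p -> A p != 0 ->
  exists W F, [/\ sphere_open W, W p, W `<=` U & log_potential W F].
Proof.
move=> Up Ap; have sC := smC shS; have sD := smD shS; have sM := smM shS.
have sq f W : sm W f -> sm W (fun q => f q ^+ 2).
  by move=> sf; apply: (sm_ext shS) (sM W f f sf sf) => q _; rewrite expr2.
have sA : sm U A by apply: (sD) => //; apply: (sM) => //; exact: sq.
pose W : set R4 := fun q => U q /\ A q != 0.
have Wo : sphere_open W by exact: sphere_open_neq0.
have WU : W `<=` U by move=> q [].
have sAW : sm W A by exact: (smS shS) sA.
have A2 q : W q -> 0 < A q ^+ 2 by move=> [_ Aq]; rewrite lt_def sqr_ge0 sqrf_eq0 Aq.
have A1 q : W q -> 0 < Num.sqrt (A q ^+ 2) by move=> /A2; rewrite sqrtr_gt0.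
(* The inner root of a square is |A|, smooth where A has no zero, whatever its sign. *)
pose F q : R := (Num.sqrt (Num.sqrt (A q ^+ 2)))^-1.
have F0 q : W q -> F q != 0 by move=> /A1 Aq; rewrite invr_eq0 gt_eqF// sqrtr_gt0.
have sF : sm W F.
  apply: (smV shS); first by move=> q Wq; rewrite -invr_eq0 F0.
  by apply: (sm_sqrt shS) => //; apply: (sm_sqrt shS) => //; exact: sq.
(* This polynomial relation is differentiated instead of the nested roots. *)
have FA q : W q -> F q ^+ 4 * A q ^+ 2 = 1.
  move=> Wq; rewrite /F exprVn (exprM _ 2 2) !sqr_sqrtr ?(ltW (A1 _ Wq)) ?(ltW (A2 _ Wq))//.
  by rewrite mulVf// gt_eqF// A2.
have st1W : sm W t1 by exact: (smS shS) st1.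
have saW : sm W a by exact: (smS shS) sa.
have FE (K : {linear R4 -> R4}) (k : R4 -> R) q : W q ->
    lie K a q + 2 * d * t1 q * lie K t1 q = 2 * A q * k q ->
    lie K F q = - F q * k q.
  move=> Wq E; have dK := lie_derivation K Wo; have smS' := shS.
  have qF := is_derE (lie K) sF; have qA := is_derE (lie K) sAW.
  have qa := is_derE (lie K) saW; have qt := is_derE (lie K) st1W.
  have /= E1 := is_der_congr dK FA ltac:(der) ltac:(der) Wq.
  have /= E2 := proj2 (is_derD shS dK qa (is_derM shS dK (is_der_cst shS dK d)
    (is_derX shS dK 2 qt))) q Wq.
  have Fq := F0 _ Wq; have [_ Aq] := Wq.
  move: E E1 E2; move: (lie K F q) (lie K A q) (lie K a q) (lie K t1 q) => x y z w E E1 E2.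
  apply: (lincomb3 (m := - (F q / (2 * A q))) (n := (4 * F q ^+ 3 * A q ^+ 2)^-1)
    (k := - (F q / (2 * A q))) E E1 E2).
  by field; rewrite Aq Fq.
exists W, F; split=> //; split=> // q Wq; apply: FE => //.
- exact: rigid_e1 (rig (WU _ Wq)).
- exact: rigid_e2 (rig (WU _ Wq)).
- exact: rigid_e3 (rig (WU _ Wq)).
Qed.

(* When [A] vanishes at [p], [B] and [t1] do not, and [t1 / B] is a potential. *)
Lemma special_potential p : U p -> A p = 0 ->
  exists W F, [/\ sphere_open W, W p, W `<=` U & log_potential W F].
Proof.
move=> Up Ap; have sC := smC shS; have sD := smD shS; have sM := smM shS.
(* t1 = 0 and A = 0 give a = 0; then [rigid2] and [rigid3] give t3 = t2 = 0, against the unit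
   length. *)
have t10 : t1 p != 0.
  apply/eqP => t10; have := flow_unit fl Up.
  have a0 : a p = 0 by move: Ap; rewrite /A t10 expr0n mulr0 addr0.
  have := rigid2 (rig Up); have := rigid3 (rig Up).
  rewrite t10 a0 !mul0r !addr0 !mul1r mulN1r => /eqP; rewrite eq_sym oppr_eq0 => /eqP -> <-.
  by rewrite expr0n !addr0 => /eqP; rewrite eq_sym oner_eq0.
(* As A vanishes, B = 1 + d t1^2 = (1 - t1^2) + t1^2 / eps, which is positive. *)
have Bp : B p != 0.
  have t1le : t1 p ^+ 2 <= 1 by rewrite -(flow_unit fl Up) -addrA lerDl addr_ge0 ?sqr_ge0.
  have t1gt : 0 < t1 p ^+ 2 by rewrite lt_def sqr_ge0 sqrf_eq0 t10.
  have e0 : 0 < eps^-1 by rewrite invr_gt0.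
  have : 0 < eps^-1 * t1 p ^+ 2 by rewrite mulr_gt0.
  by move=> h; rewrite gt_eqF//; move: Ap h; rewrite /A /B /d => Ap' h; lra.
have sq f W : sm W f -> sm W (fun q => f q ^+ 2).
  by move=> sf; apply: (sm_ext shS) (sM W f f sf sf) => q _; rewrite expr2.
have sB : sm U B.
  by apply: (sD); [apply: (sD) => //; exact: sC|apply: (sM); [exact: sC|exact: sq]].
pose W1 : set R4 := fun q => U q /\ t1 q != 0.
have W1o : sphere_open W1 by exact: sphere_open_neq0.
pose W : set R4 := fun q => W1 q /\ B q != 0.
have Wo : sphere_open W by apply: sphere_open_neq0 => //; apply: (smS shS) sB => q [].
have WU : W `<=` U by move=> q [[]].
have sBW : sm W B by exact: (smS shS) sB.
have st1W : sm W t1 by exact: (smS shS) st1.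
have saW : sm W a by exact: (smS shS) sa.
have B0 q : W q -> B q != 0 by case.
pose F q : R := t1 q * (B q)^-1.
have sF : sm W F by apply: (sM) => //; exact: (smV shS).
have F0 q : W q -> F q != 0 by move=> [[_ tq] Bq]; rewrite mulf_neq0 ?invr_eq0.
have FB q : W q -> F q * B q = t1 q by move=> Wq; rewrite /F divfK ?B0.
have FE (K : {linear R4 -> R4}) (k : R4 -> R) q : W q ->
    lie K a q + 2 * d * t1 q * lie K t1 q = 2 * A q * k q ->
    (1 + a q) * lie K t1 q = - (1 - a q) * (t1 q * k q) ->
    lie K F q = - F q * k q.
  move=> Wq E E'; have dK := lie_derivation K Wo.
  have qF := is_derE (lie K) sF; have qB := is_derE (lie K) sBW.
  have qa := is_derE (lie K) saW; have qt := is_derE (lie K) st1W.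
  have /= E1 := is_der_congr dK FB (is_derM shS dK qF qB) qt Wq.
  have /= E2 := proj2 (is_derD shS dK (is_derD shS dK (is_der_cst shS dK 1) qa)
    (is_derM shS dK (is_der_cst shS dK (2 * d)) (is_derX shS dK 2 qt))) q Wq.
  rewrite expr1 mul0r !add0r in E2.
  exact: (potential_algebra erefl erefl (B0 _ Wq) erefl E E' E1 E2).
exists W, F; split=> //; split=> // q Wq; have rq := rig (WU _ Wq);
  have [_ _ _ _ _ f11 _ _ f21 _ _ f31 _ _] := fl.
- apply: FE => //; first exact: rigid_e1 rq.
  by rewrite f11 ?(rigid1 rq) ?mulr0//; exact: WU.
- apply: FE => //; first exact: rigid_e2 rq.
  (* Since k1 = 0, e2 t1 = - (1 - a) t3, and (1 + a) t3 = t1 k2 by rigidity. *)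
  rewrite f21 ?(rigid1 rq) ?(rigid2 rq); [ring|exact: WU].
- apply: FE => //; first exact: rigid_e3 rq.
  rewrite f31 ?(rigid1 rq) ?(rigid3 rq); [ring|exact: WU].
Qed.

End Potential.

Theorem theorem1p2 (R : realType) (eps : R) (eps_gt0 : 0 < eps)
    (eps_neq1 : eps != 1)
    (nabla : ('rV[R]_4 -> 'rV[R]_4) -> ('rV[R]_4 -> 'rV[R]_4) ->
             'rV[R]_4 -> 'rV[R]_4)
    (nablaP : levi_civita eps nabla)
    (TF : 'rV[R]_4 -> set 'rV[R]_4) (foliationTF : foliation1 TF) :
  metric_foliation eps nabla TF -> homogeneous_foliation eps TF.
Proof.
move=> mf p sp.
have [U [t1 [t2 [t3 [k1 [k2 [k3 [a [Uo Up fl TFE]]]]]]]]] :=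
  foliation_flow eps_gt0 nablaP foliationTF mf sp.
have d0 : eps^-1 - 1 != 0 by rewrite subr_eq0 invr_eq1.
have rig := rigidity (smooth_sheaf_sphere R) (@sphere_open_neq0 R)
  (berger_frameP eps_gt0) d0 Uo fl.
have [W [F [Wo Wp WU [sF F0 F1 F2 F3]]]] : exists W F,
    [/\ sphere_open W, W p, W `<=` U & log_potential eps k1 k2 k3 W F].
  have [A0|A0] := eqVneq (a p + (eps^-1 - 1) * t1 p ^+ 2) 0.
    exact: (special_potential eps_gt0 Uo fl rig).
  exact: (generic_potential Uo fl rig).
exists W, (fun q => F q *: field_of eps t1 t2 t3 q); split=> //.
  exact: (killing_of_flow eps_gt0 fl Wo WU sF F1 F2 F3).
move=> q Wq; have Uq := WU _ Wq; split; last by rewrite TFE//; exists (F q).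
rewrite scaler_eq0 (negbTE (F0 _ Wq))/=; apply/eqP => T0.
have q1 := sphere_openP Uo Uq.
have := metric_comb eps_gt0 (t1 q) (t2 q) (t3 q) (t1 q) (t2 q) (t3 q) q1.
rewrite -/(field_of eps t1 t2 t3 q) T0 -!expr2 (flow_unit fl Uq) => /eqP.
have -> : berger_metric eps q 0 0 = 0.
  have := berger_metricNl eps q 0 0; rewrite oppr0 => E; lra.
by rewrite eq_sym oner_eq0.
Qed.
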